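(* (The Structure Theorem for Finitely Generated Binomial Rings.) Let $R$ be a binomial ring that is finitely generated as a ring. Then there exist an integer $k\ge 0$ and positive, square-free integers $m_1,\dots,m_k$, unique up to reordering, such that there is an isomorphism of rings $$R\cong \mathbb{Z}[m_1^{-1}]\times \cdots\times \mathbb{Z}[m_k^{-1}].$$
   Context: A commutative ring $R$ with unity is a binomial ring if it is torsion-free as a $\mathbb{Z}$-module and, regarded as a subring of $\mathbb{Q}\otimes_{\mathbb{Z}} R$, is closed under the operations $r\mapsto \frac{r(r-1)\cdots(r-n+1)}{n!}$ for all $n\in\mathbb{N}=\{0,1,2,\dots\}$. The integer $1$ counts as square-free (with $\mathbb{Z}[1^{-1}]=\mathbb{Z}$), and the empty product ($k=0$) is the zero ring. *)

(* Defs.v *)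
From HB Require Import structures.
From mathcomp Require Import all_boot all_order all_algebra.
From mathcomp Require Import generic_quotient boolp ring.

Set Implicit Arguments.
Unset Strict Implicit.
Unset Printing Implicit Defensive.

Import Order.TTheory GRing.Theory Num.Theory.
Local Open Scope ring_scope.
Local Open Scope quotient_scope.

(* The zero ring is a binomial ring, so rings are [comPzRingType]s. *)

Definition torsion_free (V : zmodType) : Prop :=
  forall (n : int) (x : V), x *~ n = 0 -> n = 0 \/ x = 0.

(* [QTensor R] is the ring Q (x)_Z R, built as the localization of R at the
   nonzero integers: the class of (r, d) is d^-1 (x) r. Theorems
   [qtens_universal] and [qtensM] show that it is the tensor product of
   Z-modules with its usual multiplication. *)
Section QTensor.
Variable R : comPzRingType.

Definition nzint := {d : int | d != 0}.
HB.instance Definition _ := Choice.on nzint.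
Definition nzint1 : nzint := exist _ 1 (oner_neq0 int).
Definition nzintM (d e : nzint) : nzint :=
  exist _ (val d * val e) (mulf_neq0 (valP d) (valP e)).
Definition nzint_den (q : rat) : nzint := exist _ (denq q) (denq_neq0 q).

Definition qpair := (R * nzint)%type.
HB.instance Definition _ := Choice.on qpair.

Implicit Types x y z : qpair.

(* R may have torsion, hence the extra factor k. *)
Definition qequiv_prop x y : Prop :=
  exists2 k : int, k != 0
    & (x.1 *~ val y.2) *~ k = (y.1 *~ val x.2) *~ k.

Definition qequiv : rel qpair := fun x y => `[< qequiv_prop x y >].

Lemma qequiv_refl : reflexive qequiv.
Proof. by move=> x; apply/asboolP; exists 1. Qed.

Lemma qequiv_sym : symmetric qequiv.
Proof. by move=> x y; apply/asboolP/asboolP => -[k k0 e]; exists k. Qed.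

Lemma mulrz_scale (V : zmodType) (u v : V) (a b c a' b' : int) :
  u *~ a = v *~ b -> a' = a * c -> b' = b * c -> u *~ a' = v *~ b'.
Proof. by move=> e -> ->; rewrite !mulrzA e. Qed.

Lemma mulrzM2 (x y : R) (a b : int) : (x * y) *~ (a * b) = x *~ a * (y *~ b).
Proof. by rewrite mulrzAl mulrzAr -mulrzA mulrC [b * a]mulrC mulrC. Qed.

Lemma qequiv_trans : transitive qequiv.
Proof.
move=> [y [b b0]] [x [a a0]] [z [c c0]] /asboolP[k k0 /= e].
move=> /asboolP[l l0 /= f]; apply/asboolP.
exists (k * l * b); first by rewrite !mulf_neq0.
rewrite /= -!mulrzA in e f *.
transitivity (y *~ (a * k * (c * l))).
  by apply: (mulrz_scale (c := c * l) e); ring.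
by apply: (mulrz_scale (c := a * k) f); ring.
Qed.

Canonical qequiv_equiv := EquivRel qequiv qequiv_refl qequiv_sym qequiv_trans.

Definition QTensor := {eq_quot qequiv}.
HB.instance Definition _ : EqQuotient _ qequiv QTensor := EqQuotient.on QTensor.
HB.instance Definition _ := Choice.on QTensor.

Lemma qequivP x y : reflect (qequiv_prop x y) (x == y %[mod QTensor]).
Proof. by rewrite eqmodE; exact: asboolP. Qed.

Lemma eq_qpi x y :
  \pi_QTensor x = \pi_QTensor y <-> qequiv_prop x y.
Proof. by split=> [/eqP/qequivP | /qequivP/eqP]. Qed.

Lemma qequiv_repr x : qequiv_prop (repr (\pi_QTensor x)) x.
Proof. by apply/eq_qpi; rewrite reprK. Qed.

Definition qpair_add x y : qpair :=
  (x.1 *~ val y.2 + y.1 *~ val x.2, nzintM x.2 y.2).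
Definition qpair_opp x : qpair := (- x.1, x.2).
Definition qpair_mul x y : qpair := (x.1 * y.1, nzintM x.2 y.2).

Definition qt_zero : QTensor := \pi_QTensor (0, nzint1).
Definition qt_one : QTensor := \pi_QTensor (1, nzint1).
Definition qt_add := lift_op2 QTensor qpair_add.
Definition qt_opp := lift_op1 QTensor qpair_opp.
Definition qt_mul := lift_op2 QTensor qpair_mul.

Lemma qpair_add_equiv x x' y y' : qequiv_prop x x' -> qequiv_prop y y' ->
  qequiv_prop (qpair_add x y) (qpair_add x' y').
Proof.
case: x x' y y' => [x [a ?]] [x' [a' ?]] [y [b ?]] [y' [b' ?]].
move=> [k k0 /= e] [l l0 /= f]; exists (k * l); first by rewrite mulf_neq0.
rewrite /= !mulrzDl -!mulrzA in e f *; congr (_ + _).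
  by apply: (mulrz_scale (c := b * b' * l) e); ring.
by apply: (mulrz_scale (c := a * a' * k) f); ring.
Qed.

Lemma qpair_mul_equiv x x' y y' : qequiv_prop x x' -> qequiv_prop y y' ->
  qequiv_prop (qpair_mul x y) (qpair_mul x' y').
Proof.
case: x x' y y' => [x [a ?]] [x' [a' ?]] [y [b ?]] [y' [b' ?]].
move=> [k k0 /= e] [l l0 /= f]; exists (k * l); first by rewrite mulf_neq0.
rewrite /= -!mulrzA in e f *.
have -> : a' * b' * (k * l) = a' * k * (b' * l) by ring.
have -> : a * b * (k * l) = a * k * (b * l) by ring.
by rewrite !mulrzM2 e f.
Qed.

Lemma qpair_opp_equiv x x' :
  qequiv_prop x x' -> qequiv_prop (qpair_opp x) (qpair_opp x').
Proof. by move=> [k k0 e]; exists k; rewrite //= !mulNrz e. Qed.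

Lemma pi_qt_add : {morph \pi : x y / qpair_add x y >-> qt_add x y}.
Proof.
move=> x y; unlock qt_add; apply/esym/eq_qpi.
by apply: qpair_add_equiv; exact: qequiv_repr.
Qed.
Canonical pi_qt_add_morph := PiMorph2 pi_qt_add.

Lemma pi_qt_opp : {morph \pi : x / qpair_opp x >-> qt_opp x}.
Proof.
move=> x; unlock qt_opp; apply/esym/eq_qpi.
by apply: qpair_opp_equiv; exact: qequiv_repr.
Qed.
Canonical pi_qt_opp_morph := PiMorph1 pi_qt_opp.

Lemma pi_qt_mul : {morph \pi : x y / qpair_mul x y >-> qt_mul x y}.
Proof.
move=> x y; unlock qt_mul; apply/esym/eq_qpi.
by apply: qpair_mul_equiv; exact: qequiv_repr.
Qed.
Canonical pi_qt_mul_morph := PiMorph2 pi_qt_mul.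

Lemma eq_qpi1 x y :
  x.1 *~ val y.2 = y.1 *~ val x.2 -> \pi_QTensor x = \pi_QTensor y.
Proof. by move=> e; apply/eq_qpi; exists 1; rewrite ?e. Qed.

Lemma qt_addA : associative qt_add.
Proof.
elim/quotW=> x; elim/quotW=> y; elim/quotW=> z; rewrite !piE.
apply: eq_qpi1; rewrite /= !mulrzDl -!mulrzA !addrA.
by congr (_ *~ _ + _ *~ _ + _ *~ _); ring.
Qed.

Lemma qt_addC : commutative qt_add.
Proof.
elim/quotW=> x; elim/quotW=> y; rewrite !piE.
by apply: eq_qpi1; rewrite /= addrC [val x.2 * _]mulrC.
Qed.

Lemma qt_add0 : left_id qt_zero qt_add.
Proof.
elim/quotW=> x; rewrite /qt_zero !piE; apply: eq_qpi1.
by rewrite /= mul0rz add0r mulr1z mul1r.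
Qed.

Lemma qt_addN : left_inverse qt_zero qt_opp qt_add.
Proof.
elim/quotW=> x; rewrite /qt_zero !piE; apply: eq_qpi1.
by rewrite /= mulNrz addNr !mul0rz.
Qed.

HB.instance Definition _ :=
  GRing.isZmodule.Build QTensor qt_addA qt_addC qt_add0 qt_addN.

Lemma qt_mulA : associative qt_mul.
Proof.
elim/quotW=> x; elim/quotW=> y; elim/quotW=> z; rewrite !piE.
by apply: eq_qpi1; rewrite /= !mulrA.
Qed.

Lemma qt_mulC : commutative qt_mul.
Proof.
elim/quotW=> x; elim/quotW=> y; rewrite !piE.
by apply: eq_qpi1; rewrite /= mulrC [val x.2 * _]mulrC.
Qed.

Lemma qt_mul1 : left_id qt_one qt_mul.
Proof.
by elim/quotW=> x; rewrite /qt_one !piE; apply: eq_qpi1; rewrite /= !mul1r.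
Qed.

Lemma qt_mulDl : left_distributive qt_mul qt_add.
Proof.
elim/quotW=> x; elim/quotW=> y; elim/quotW=> z; rewrite !piE.
apply: eq_qpi1; rewrite /= mulrDl !mulrzDl !mulrzAl -!mulrzA.
by congr (_ *~ _ + _ *~ _); ring.
Qed.

HB.instance Definition _ :=
  GRing.Zmodule_isComPzRing.Build QTensor qt_mulA qt_mulC qt_mul1 qt_mulDl.

Definition qtens (q : rat) (r : R) : QTensor :=
  \pi_QTensor (r *~ numq q, nzint_den q).

Lemma qpiD x y :
  \pi_QTensor x + \pi_QTensor y = \pi_QTensor (qpair_add x y).
Proof. by rewrite pi_qt_add. Qed.

Lemma qpiM x y :
  \pi_QTensor x * \pi_QTensor y = \pi_QTensor (qpair_mul x y).
Proof. by rewrite pi_qt_mul. Qed.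

Lemma qtensE (q : rat) (r : R) (a : int) (d : nzint) :
  q * (val d)%:~R = a%:~R -> qtens q r = \pi_QTensor (r *~ a, d).
Proof.
move=> e; apply: eq_qpi1; rewrite /= -!mulrzA; congr (_ *~ _).
apply: (@intr_inj rat); rewrite !rmorphM /= -e.
by rewrite numqE mulrAC.
Qed.

Lemma qtens_pi x : \pi_QTensor x = qtens (val x.2)%:~R^-1 x.1.
Proof.
rewrite (@qtensE _ _ 1 x.2) ?mulr1z ?mulVf ?intr_eq0 ?(valP x.2) //.
by case: x.
Qed.

Lemma qtensDl (p q : rat) (r : R) : qtens (p + q) r = qtens p r + qtens q r.
Proof.
rewrite qpiD (@qtensE _ _ (numq p * denq q + numq q * denq p)
  (nzintM (nzint_den p) (nzint_den q))).
  by apply: eq_qpi1; rewrite /= mulrzDr !mulrzA.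
by rewrite rmorphD !rmorphM /= mulrDl !numqE !mulrA (mulrAC q).
Qed.

Lemma qtensDr (q : rat) (r s : R) : qtens q (r + s) = qtens q r + qtens q s.
Proof.
rewrite qpiD; apply: eq_qpi1; rewrite /= !mulrzDl -!mulrzA.
by congr (_ *~ _ + _ *~ _); ring.
Qed.

Lemma qtensM (p q : rat) (r s : R) :
  qtens p r * qtens q s = qtens (p * q) (r * s).
Proof.
rewrite qpiM (@qtensE _ _ (numq p * numq q)
  (nzintM (nzint_den p) (nzint_den q))); first by rewrite mulrzM2.
by rewrite !rmorphM /= mulrACA !numqE.
Qed.

Lemma qtens11 : qtens 1 1 = 1.
Proof. by apply: eq_qpi1; rewrite /= mulr1z. Qed.

Lemma qtens_zmod_morphism (q : rat) : zmod_morphism (qtens q).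
Proof.
by move=> r s; apply/esym/(canLR (addrK _)); rewrite -qtensDr subrK.
Qed.

Lemma qtens1_monoid_morphism : monoid_morphism (qtens 1).
Proof. by split=> [|r s]; rewrite ?qtens11 // qtensM mulr1. Qed.

HB.instance Definition _ :=
  GRing.isZmodMorphism.Build R QTensor (qtens 1) (qtens_zmod_morphism 1).
HB.instance Definition _ :=
  GRing.isMonoidMorphism.Build R QTensor (qtens 1) qtens1_monoid_morphism.

Lemma qtens1_inj : torsion_free R -> injective (qtens 1).
Proof.
move=> tf r s /eq_qpi[k k0 /= e].
rewrite !mulr1z in e; have /tf : (r - s) *~ k = 0.
  by rewrite mulrzBl e subrr.
by case=> [k_eq0 | /eqP]; [rewrite k_eq0 eqxx in k0 | rewrite subr_eq0 => /eqP].
Qed.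

Theorem qtens_universal (V : zmodType) (f : rat -> R -> V) :
    (forall r, zmod_morphism (f^~ r)) -> (forall q, zmod_morphism (f q)) ->
  exists2 g : {additive QTensor -> V}, (forall q r, g (qtens q r) = f q r)
    & forall h : {additive QTensor -> V},
        (forall q r, h (qtens q r) = f q r) -> h =1 g.
Proof.
move=> fl fr.
have fz q r (n : int) : f (q * n%:~R) r = f q (r *~ n).
  pose fl' := GRing.isZmodMorphism.Build _ _ _ (fl r).
  pose fr' := GRing.isZmodMorphism.Build _ _ _ (fr q).
  pose F : {additive rat -> V} := HB.pack (f^~ r) fl'.
  pose G : {additive R -> V} := HB.pack (f q) fr'.
  by rewrite mulrzr -[LHS]/(F (q *~ n)) -[RHS]/(G (r *~ n)) !raddfMz.
pose g0 (t : QTensor) := f (val (repr t).2)%:~R^-1 (repr t).1.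
have g0pi x : g0 (\pi_QTensor x) = f (val x.2)%:~R^-1 x.1.
  rewrite /g0; case: (repr _) (qequiv_repr x) => r [d d0] [k k0] /=.
  case: x => s [e e0] /= E.
  have nz (n : int) : n != 0 -> (n%:~R : rat) != 0 by rewrite intr_eq0.
  have -> : d%:~R^-1 = ((d * e * k)%:~R^-1 * (e * k)%:~R) :> rat.
    by rewrite !intrM; field; rewrite !nz.
  have -> : e%:~R^-1 = ((d * e * k)%:~R^-1 * (d * k)%:~R) :> rat.
    by rewrite !intrM; field; rewrite !nz.
  by rewrite !fz !mulrzA E.
have g0tens q r : g0 (qtens q r) = f q r.
  by rewrite g0pi /= -fz mulrC divq_num_den.
have g0B : zmod_morphism g0.
  have g0D t u : g0 (t + u) = g0 t + g0 u.
    elim/quotW: t => x; elim/quotW: u => y; rewrite qpiD !g0pi /=.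
    case: x y => r [d d0] [s [e e0]] /=.
    have nz (n : int) : n != 0 -> (n%:~R : rat) != 0 by rewrite intr_eq0.
    pose fr' := GRing.isZmodMorphism.Build _ _ _ (fr (d * e)%:~R^-1).
    pose G : {additive R -> V} := HB.pack (f (d * e)%:~R^-1) fr'.
    rewrite -[LHS]/(G _) raddfD /= -!fz !intrM.
    by congr (f _ _ + f _ _); field; rewrite !nz.
  by move=> t u; apply/esym/(canLR (addrK _)); rewrite -g0D subrK.
pose g0' := GRing.isZmodMorphism.Build _ _ _ g0B.
exists (HB.pack_for {additive QTensor -> V} g0 g0') => // h hf t.
by elim/quotW: t => x; rewrite qtens_pi hf -g0tens.
Qed.

End QTensor.

Arguments qtens {R} q r.

(* r |-> r (r - 1) ... (r - n + 1) / n! *)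
Definition qbinom (R : comPzRingType) (r : QTensor R) (n : nat) : QTensor R :=
  qtens (n`!%:R^-1) 1 * \prod_(i < n) (r - i%:R).

(* R is embedded in Q (x) R by r |-> 1 (x) r. *)
Definition binomial_ring (R : comPzRingType) : Prop :=
  torsion_free R /\
  forall (r : R) (n : nat), exists s : R, qbinom (qtens 1 r) n = qtens 1 s.

Lemma qbinom_mem (R : comPzRingType) (r s : R) (n : nat) : torsion_free R ->
  qbinom (qtens 1 r) n = qtens 1 s <-> s *+ n`! = \prod_(i < n) (r - i%:R).
Proof.
move=> tf; set p := \prod_(i < n) (r - i%:R).
have -> : qbinom (qtens 1 r) n = qtens n`!%:R^-1 p.
  rewrite /qbinom.
  have -> : \prod_(i < n) (qtens 1 r - i%:R) = qtens 1 p.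
    rewrite rmorph_prod; apply: eq_bigr => i _.
    by rewrite rmorphB rmorph_nat.
  by rewrite qtensM mulr1 mul1r.
have f0 : (n`!%:R : rat) != 0 by rewrite pnatr_eq0 -lt0n fact_gt0.
have mulE q (t : R) : qtens q t * qtens n`!%:R 1 = qtens (q * n`!%:R) t.
  by rewrite qtensM mulr1.
have natE t : qtens n`!%:R t = qtens 1 (t *+ n`!).
  rewrite (@qtensE _ _ _ n`! (nzint1)) ?mulr1 //.
  by apply: eq_qpi1; rewrite /= !mulr1z.
split=> [e | e].
  apply: (qtens1_inj tf); rewrite -natE -[n`!%:R]mul1r -mulE -e mulE.
  by rewrite mulVf.
have -> : n`!%:R^-1 = 1 * n`!%:R^-1 :> rat by rewrite mul1r.
have -> : qtens (1 * n`!%:R^-1) p = qtens n`!%:R^-1 1 * qtens 1 p.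
  by rewrite qtensM mulr1 !mul1r.
by rewrite -e -natE qtensM mulVf // mul1r.
Qed.

Definition finitely_generated_ring (R : comPzRingType) : Prop :=
  exists gs : seq R, forall S : {pred R},
    subring_closed S -> {subset gs <= S} -> forall x, x \in S.

(* The subring Z[m^-1] of Q, for m > 0. *)
Definition Zinv_pred (m : nat) : {pred rat} :=
  fun x => `[< exists p : {poly int}, x = (map_poly intr p).[m%:R^-1] >].

Lemma Zinv_closed m : subring_closed (Zinv_pred m).
Proof.
split.
- by apply/asboolP; exists 1; rewrite rmorph1 hornerC.
- move=> x y /asboolP[p ->] /asboolP[q ->]; apply/asboolP.
  by exists (p - q); rewrite rmorphB hornerD hornerN.
- move=> x y /asboolP[p ->] /asboolP[q ->]; apply/asboolP.
  by exists (p * q); rewrite rmorphM hornerM.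
Qed.

HB.instance Definition _ m :=
  GRing.isSubringClosed.Build rat (Zinv_pred m) (Zinv_closed m).

Record Zinv (m : nat) := MkZinv { Zinv_val : rat; _ : Zinv_val \in Zinv_pred m }.

HB.instance Definition _ m := [isSub for @Zinv_val m].
HB.instance Definition _ m := [Choice of Zinv m by <:].
HB.instance Definition _ m := [SubChoice_isSubComNzRing of Zinv m by <:].

(* The product of a finite family of rings. *)
Section RingProd.
Variables (I : finType) (A : I -> comPzRingType).

Definition ringprod := {dffun forall i, A i}.
HB.instance Definition _ := Choice.on ringprod.

Implicit Types x y z : ringprod.

Definition rp_zero : ringprod := [ffun i => 0 : A i].
Definition rp_one : ringprod := [ffun i => 1 : A i].
Definition rp_opp x : ringprod := [ffun i => - x i].
Definition rp_add x y : ringprod := [ffun i => x i + y i].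
Definition rp_mul x y : ringprod := [ffun i => x i * y i].

Lemma rp_addA : associative rp_add.
Proof. by move=> x y z; apply/ffunP=> i; rewrite !ffunE addrA. Qed.
Lemma rp_addC : commutative rp_add.
Proof. by move=> x y; apply/ffunP=> i; rewrite !ffunE addrC. Qed.
Lemma rp_add0 : left_id rp_zero rp_add.
Proof. by move=> x; apply/ffunP=> i; rewrite !ffunE add0r. Qed.
Lemma rp_addN : left_inverse rp_zero rp_opp rp_add.
Proof. by move=> x; apply/ffunP=> i; rewrite !ffunE addNr. Qed.

HB.instance Definition _ :=
  GRing.isZmodule.Build ringprod rp_addA rp_addC rp_add0 rp_addN.

Lemma rp_mulA : associative rp_mul.
Proof. by move=> x y z; apply/ffunP=> i; rewrite !ffunE mulrA. Qed.
Lemma rp_mulC : commutative rp_mul.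
Proof. by move=> x y; apply/ffunP=> i; rewrite !ffunE mulrC. Qed.
Lemma rp_mul1 : left_id rp_one rp_mul.
Proof. by move=> x; apply/ffunP=> i; rewrite !ffunE mul1r. Qed.
Lemma rp_mulDl : left_distributive rp_mul rp_add.
Proof. by move=> x y z; apply/ffunP=> i; rewrite !ffunE mulrDl. Qed.

HB.instance Definition _ :=
  GRing.Zmodule_isComPzRing.Build ringprod rp_mulA rp_mulC rp_mul1 rp_mulDl.

End RingProd.

Definition ring_isomorphic (A B : pzRingType) : Prop :=
  exists f : {rmorphism A -> B}, bijective f.

Definition Zinv_prod (k : nat) (m : k.-tuple nat) : comPzRingType :=
  ringprod (fun i : 'I_k => Zinv (tnth m i)).

Definition positive_squarefree (m : nat) : Prop :=
  (0 < m)%N /\ forall d : nat, (d ^ 2 %| m)%N -> d = 1%N.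

(* Main.v *)
(* Reducing a presentation of [R] by a Groebner basis gives an integer [N > 0]
   such that the standard monomials are a basis of [R[1/N]] over [Z[1/N]]. For a
   prime [p] not dividing [N], the binomial coefficients over [p] bound the
   exponents of the standard monomials by [p], so that there are finitely many of
   them and [R] acts faithfully on [Q^d] by matrices with entries in [Z[1/N]].

   In a binomial ring a Vandermonde product of [M] elements is divisible by
   [0! 1! ... (M - 1)!]. Applied to the elements [x + y a] with [0 <= x, y < m]
   and combined with the size of determinants, this forces every [a] in [R] to
   have a rational eigenvalue in each such representation. As [R] is also
   reduced, it acts through simultaneously diagonalizable rational matrices, and
   the diagonal entries are ring morphisms [R -> Q], finitely many and jointly
   injective. If [b] is a positive integer [D] at one of them and [0] at the
   others, the binomial coefficient of [b] over [D] is the corresponding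
   idempotent, so [R] is the product of its images in [Q]. These morphisms and
   their images are intrinsic, whence uniqueness. *)

From HB Require Import structures.
From mathcomp Require Import all_boot all_order all_algebra.
From mathcomp Require Import perm boolp mpoly ring zify.
Require Import Defs.

Set Implicit Arguments.
Unset Strict Implicit.
Unset Printing Implicit Defensive.

Import Order.TTheory GRing.Theory Num.Theory.

(** * Superfactorials *)

Lemma bin_le_exp2 n k : 'C(n, k) <= 2 ^ n.
Proof.
elim: n k => [|n IHn] [|k]; rewrite ?bin0 ?expn_gt0 //.
by rewrite binS expnS mul2n -addnn leq_add.
Qed.

(** Both sides are compared with ['C(2n, n) * n! = 2n (2n - 1) ... (n + 1)], a product of [n]
    factors that exceed [n]; the binomial coefficient is at most [4 ^ n]. *)
Lemma expnn_le_fact n : n ^ n <= 4 ^ n * n`!.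
Proof.
apply: (@leq_trans ('C(n.*2, n) * n`!)); last first.
  by rewrite leq_mul2r (_ : 4 ^ n = 2 ^ n.*2) ?bin_le_exp2 ?orbT // -mul2n expnM.
rewrite bin_ffact ffact_prod.
rewrite -[X in n ^ X]card_ord -prod_nat_const.
by apply: leq_prod => i _; have := ltn_ord i; lia.
Qed.

Lemma sum_ord_double n : (\sum_(i < n) i).*2 = n * n.-1.
Proof.
elim: n => [|n IHn]; first by rewrite big_ord0.
rewrite big_ord_recr /= doubleD IHn; nia.
Qed.

(** Only the upper half [j = h + i] of the product is used: there [j! * 4 ^ j >= j ^ j >= h ^ j],
    and the exponents add up to [h * (3 * h - 1) / 2]. Squaring removes the halves. *)
Lemma superfactorial_lower h :
  h ^ (h * (3 * h - 1)) <=
    ((\prod_(j < 2 * h) j`!) * 4 ^ (\sum_(j < 2 * h) j)) ^ 2.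
Proof.
have -> : h * (3 * h - 1) = (\sum_(i < h) (h + i)) * 2.
  rewrite big_split /= sum_nat_const card_ord muln2 doubleD sum_ord_double.
  by nia.
rewrite expnM leq_exp2r // !expn_sum -big_split /= mul2n -addnn big_split_ord /=.
rewrite -[X in X <= _]mul1n; apply: leq_mul.
  by rewrite prodn_gt0 // => i; rewrite muln_gt0 fact_gt0 expn_gt0.
apply: leq_prod => i _; rewrite [X in _ <= X]mulnC.
apply: leq_trans (expnn_le_fact _); rewrite leq_exp2r ?leq_addr //.
by have := ltn_ord i; lia.
Qed.

(** Up to constants to the power [m ^ 4], the lower bound for the right side is [m ^ (3 m ^ 4 / 4)],
    whereas the left side is [m ^ (m ^ 4 / 2)]. *)
Lemma superfactorial_gt C :
  exists m, (C * m) ^ (\sum_(j < m ^ 2) j) < \prod_(j < m ^ 2) j`!.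
Proof.
(* With [m = 2 * D] and [h = 2 * D ^ 2] this gives [(4 * C * m) ^ 2 = 32 * C ^ 2 * h <= D * h]. *)
have [D [D0 leD]] : exists D, 0 < D /\ 32 * C ^ 2 <= D.
  by exists (32 * C ^ 2).+1.
have [h hE] : exists h, h = 2 * D ^ 2 by eexists.
exists (2 * D); have -> : (2 * D) ^ 2 = 2 * h by rewrite hE expnMn -mulnA.
rewrite ltnNge; apply/negP => le_sf.
have dK := sum_ord_double (2 * h); set K := \sum_(_ < _) _ in le_sf dK.
have h0 : 0 < h by rewrite hE muln_gt0 expn_gt0 D0.
have le1 : h ^ (h * (3 * h - 1)) <= (D * h) ^ (h * (2 * h - 1)).
  have -> : h * (2 * h - 1) = K.
    by apply: double_inj; rewrite dK -mul2n mulnA subn1.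
  apply: leq_trans (superfactorial_lower h) _; rewrite -/K.
  apply: (@leq_trans (((C * (2 * D)) ^ K * 4 ^ K) ^ 2)).
    by rewrite leq_exp2r // leq_mul2r le_sf orbT.
  rewrite -expnMn expnAC; case: K {le_sf dK} => // K.
  rewrite leq_exp2r // (_ : _ ^ 2 = 32 * C ^ 2 * h); last by rewrite hE; ring.
  by rewrite leq_mul2r leD orbT.
(* The surplus factor [h ^ (h * h)] on the right beats [D ^ (2 * (h * h))], because
   [h = 2 * D ^ 2 > D ^ 2]. *)
have /leq_trans/(_ le1) :
    D ^ (h * (2 * h - 1)) * h ^ (h * (2 * h - 1)) < h ^ (h * (3 * h - 1)).
  have -> : 3 * h - 1 = h + (2 * h - 1) by clear - h0; lia.
  rewrite mulnDr expnD ltn_mul2r expn_gt0 h0 /=.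
  apply: (@leq_ltn_trans (D ^ (2 * (h * h)))).
    by rewrite leq_pexp2l // mulnCA leq_mul2l leq_subr orbT.
  rewrite expnM ltn_exp2r ?muln_gt0 ?h0 // hE mul2n -addnn.
  by rewrite -[X in X < _]addn0 ltn_add2l expn_gt0 D0.
by rewrite -expnMn ltnn.
Qed.

Lemma logn_fact_le p n : prime p -> logn p n`! <= n.
Proof.
move=> pr_p; rewrite logn_fact //.
(* The last quotient in Legendre's formula is counted twice to make the induction go through: as
   [p >= 2], twice the next quotient is at most this one. *)
have H m k0 : \sum_(1 <= k < k0.+1) m %/ p ^ k + m %/ p ^ k0 <= m.
  elim: k0 => [|k0 IHk]; first by rewrite big_geq // divn1.
  rewrite big_nat_recr //= -addnA; apply: leq_trans IHk; rewrite leq_add2l.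
  rewrite addnn -muln2 expnSr divnMA.
  by apply: leq_trans (leq_trunc_div _ p); rewrite leq_mul2l prime_gt1 ?orbT.
by apply: leq_trans (H n n); rewrite leq_addr.
Qed.

(** Here [s] collects the primes dividing [N]. Each of them occurs in [n!] at most [n] times, so [s]
    divides [N ^ n]. *)
Lemma fact_coprime_part N n : 0 < N ->
  exists s t, [/\ n`! = s * t, coprime t N & s <= N ^ n].
Proof.
move=> N0; exists (n`!`_\pi(N)), (n`!`_(\pi(N)^')); split.
- by rewrite partnC // fact_gt0.
- by rewrite coprime_sym coprime_pi' ?part_pnat.
apply: dvdn_leq; first by rewrite expn_gt0 N0.
apply/dvdn_partP => [|p]; first exact: part_gt0.
rewrite pi_of_part ?fact_gt0 // inE /= => /andP[_ piNp].
have [pr_p pN] : prime p /\ p %| N.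
  by move: piNp; rewrite mem_primes => /and3P[].
rewrite partn_part; last first.
  by move=> q; rewrite !inE => /eqP->.
rewrite p_part; apply: dvdn_trans (dvdn_exp2l _ (logn_fact_le n pr_p)) _.
exact: dvdn_exp2r.
Qed.

Lemma superfactorial_coprime_part N M : 0 < N ->
  exists s t, [/\ \prod_(j < M) j`! = s * t, coprime t N
    & s <= N ^ (\sum_(j < M) j)].
Proof.
move=> N0; elim: M => [|M [s [t [e co le_s]]]].
  by exists 1, 1; rewrite !big_ord0 coprime1n.
have [s' [t' [e' co' le_s']]] := fact_coprime_part M N0.
exists (s * s'), (t * t'); rewrite !big_ord_recr /= e e' mulnACA coprimeMl co co'.
by rewrite expnD leq_mul.
Qed.

(** The part of the superfactorial prime to [N] has to divide [L], while the rest is small on its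
    own. The bound is therefore independent of the power [e]. *)
Lemma superfactorial_exp_le N M D e L : 0 < N -> 0 < L ->
    (\prod_(j < M) j`!) ^ D %| N ^ e * L ->
  (\prod_(j < M) j`!) ^ D <= (N ^ (\sum_(j < M) j)) ^ D * L.
Proof.
move=> N0 L0; have [s [t [-> co le_s]]] := superfactorial_coprime_part M N0.
rewrite expnMn => dv; apply: leq_mul.
  by case: (D) => // ?; rewrite leq_exp2r.
apply: dvdn_leq => //; rewrite -(@Gauss_dvdr _ (N ^ e)).
  exact: dvdn_trans (dvdn_mull _ _) dv.
by rewrite coprimeXl ?coprimeXr.
Qed.

(** * Divisibility of Vandermonde products *)

Local Open Scope ring_scope.

(** The binomial closure condition with denominators cleared, expressed inside [R] itself instead of
    [QTensor R]. *)
Definition has_binomials (R : comPzRingType) : Prop :=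
  forall (r : R) n, exists s : R, s *+ n`! = \prod_(i < n) (r - i%:R).

(** This reduces statements proved with polynomials to nonzero rings, the zero ring being treated
    apart. *)
Lemma nonzero_ringW (P : comPzRingType -> Prop) (R : comPzRingType) :
  (forall S : comNzRingType, P S) -> (1 : R) != 0 -> P R.
Proof.
move=> PS; case: R => T; case=> > nz.
match goal with |- P ?R =>
  pose R1 := GRing.PzSemiRing_isNonZero.Build R nz;
  exact: (PS (HB.pack T R R1))
end.
Qed.

(* By row operations, the Vandermonde determinant is that of the falling
   factorials [z (z - 1) ... (z - j + 1)], each divisible by [j!]. *)
Lemma prod_factorial_dvd_Vandermonde_nz (R : comNzRingType) M (z : 'I_M -> R) :
    has_binomials R ->
  exists w, w *+ (\prod_(j < M) j`!) =
    \prod_(i < M) \prod_(j < M | (i < j)%N) (z j - z i).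
Proof.
move=> bin.
pose b (j : 'I_M) (i : 'I_M) := sval (cid (bin (z j) i)).
have bE j i : b j i *+ i`! = \prod_(k < i) (z j - k%:R).
  by rewrite /b; case: cid.
pose P i : {poly R} := \prod_(k < i) ('X - k%:R%:P).
have sizeP i : size (P i) = i.+1.
  by rewrite /P size_prod_XsubC -[index_enum _]enumT size_enum_ord.
have monP i : P i \is monic by rewrite monic_prod_XsubC.
pose T := \matrix_(i < M, l < M) (P i)`_l.
pose V := Vandermonde M (\row_j z j).
have TV : T *m V = \matrix_(i, j) (b j i *+ i`!).
  apply/matrixP=> i j; rewrite !mxE bE.
  have -> : \prod_(k < i) (z j - k%:R) = (P i).[z j].
    by rewrite horner_prod; apply: eq_bigr => k _; rewrite !hornerE.
  rewrite (@horner_coef_wide _ M) ?sizeP //.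
  by apply: eq_bigr => l _; rewrite !mxE.
have detT : \det T = 1.
  rewrite det_trig; last first.
    apply/is_trig_mxP => i j lt_ij; rewrite mxE nth_default // sizeP //.
  rewrite big1 // => i _; rewrite mxE.
  by have /monicP := monP i; rewrite lead_coefE sizeP.
exists (\det (\matrix_(i, j) b j i)).
have -> : \prod_(i < M) \prod_(j < M | (i < j)%N) (z j - z i) = \det V.
  by rewrite det_Vandermonde; do 2! apply: eq_bigr => ? _; rewrite !mxE.
rewrite -[RHS]mul1r -detT -det_mulmx TV.
have -> : \matrix_(i, j) (b j i *+ i`!) =
    diag_mx (\row_i i`!%:R) *m \matrix_(i, j) b j i.
  by apply/matrixP=> i j; rewrite mul_diag_mx !mxE mulr_natl.
rewrite det_mulmx det_diag -mulr_natl; congr (_ * _).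
by rewrite natr_prod; apply: eq_bigr => i _; rewrite mxE.
Qed.

Lemma prod_factorial_dvd_Vandermonde (R : comPzRingType) M (z : 'I_M -> R) :
    has_binomials R ->
  exists w, w *+ (\prod_(j < M) j`!) =
    \prod_(i < M) \prod_(j < M | (i < j)%N) (z j - z i).
Proof.
have [e10|nz] := eqVneq (1 : R) 0.
  by move=> _; exists 0; rewrite -[LHS]mulr1 -[RHS]mulr1 e10 !mulr0.
move: z; pattern R; refine (nonzero_ringW _ nz) => S z.
exact: prod_factorial_dvd_Vandermonde_nz.
Qed.

(** * Rational eigenvalues *)

Lemma absz_det_le D (B : 'M[int]_D) c :
  (forall i j, `|B i j|%N <= c)%N -> (`|\det B| <= D`! * c ^ D)%N.
Proof.
move=> leB; rewrite -lez_nat abszE; apply: le_trans (ler_norm_sum _ _ _) _.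
rewrite -[X in _ <= X]natz natrM -card_Sn mulr_natl -sumr_const.
apply: ler_sum => s _.
rewrite normrM normrX normrN1 expr1n mul1r normr_prod natrX.
rewrite -[X in _ ^+ X]card_ord -prodr_const.
by apply: ler_prod => i _; rewrite normr_ge0 -abszE natz lez_nat leB.
Qed.

(** For [N > 0] these are the matrices over [Z[1/N]]. *)
Definition integral_after (N : nat) d (A : 'M[rat]_d) : Prop :=
  exists k (B : 'M[int]_d), map_mx intr B = (N ^ k)%:R *: A.

(** For [y != 0], a kernel vector of [x + y q A] would be an eigenvector of [A] for [- x / (y q)];
    for [y = 0] the matrix is a nonzero scalar. *)
Lemma eigenvalue_affine d (A : 'M[rat]_d) (x y : int) (B : 'M[int]_d) (q : rat) :
    (0 < d)%N -> q != 0 -> map_mx intr B = q *: A -> (x != 0) || (y != 0) ->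
  (forall c, ~~ eigenvalue A c) -> \det (x%:M + y *: B) != 0.
Proof.
move=> d0 q0 BE nz noeig.
have [y0|y0] := eqVneq y 0.
  move: nz; rewrite y0 eqxx orbF => x0.
  by rewrite scale0r addr0 det_scalar expf_neq0.
apply/negP; rewrite -(intr_eq0 rat) -det_map_mx => /det0P[v v0].
rewrite map_mxD map_scalar_mx map_mxZ BE /= mulmxDr mul_mx_scalar scalerA.
rewrite -scalemxAr => e.
have /negP := noeig (- (x%:~R / (y%:~R * q))); apply.
apply/eigenvalueP; exists v => //.
have yq0 : y%:~R * q != 0 by rewrite mulf_neq0 ?intr_eq0.
apply: (scalerI yq0); rewrite scalerA mulrN mulrCA divff // mulr1 scaleNr.
by apply/eqP; rewrite -addr_eq0 addrC e.
Qed.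

(* If [a] had no rational eigenvalue, the Vandermonde product of the [m ^ 2]
   elements [x + y a], [0 <= x, y < m], would have nonzero determinant, of size
   about [m ^ (d m ^ 4 / 2)]. But up to powers of [N] this integer is divisible
   by the [d]-th power of [0! 1! ... (m ^ 2 - 1)!], of size [m ^ (d m ^ 4)]. *)
Lemma exists_rational_eigenvalue (R : comPzRingType) d N
    (rho : {rmorphism R -> 'M[rat]_d}) :
    has_binomials R -> (0 < d)%N -> (0 < N)%N ->
    (forall r, integral_after N (rho r)) ->
  forall a, exists c, eigenvalue (rho a) c.
Proof.
move=> bin d0 N0 int_rho a; apply: contrapT => noeig0.
have noeig c : ~~ eigenvalue (rho a) c by apply/negP => ?; apply: noeig0; exists c.
have [k [A AE]] := int_rho a.
have Nk0 : (N ^ k)%:R != 0 :> rat by rewrite pnatr_eq0 -lt0n expn_gt0 N0.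
pose c0 := (\sum_i \sum_j `|A i j|)%N.
have c0P i j : (`|A i j| <= c0)%N.
  by rewrite /c0 (bigD1 i) //= (bigD1 j) //= -addnA leq_addr.
(* Chosen so that the determinants of the differences below are at most [(E * m) ^ d]. The extra
   factor [N] in the next line pays for the primes dividing [N]. *)
pose E := (d`! * c0.+1)%N.
have [m ltm] := superfactorial_gt (N * E); set M := (m ^ 2)%N in ltm.
(* An index [i < m ^ 2] encodes the pair of its quotient and remainder by [m]; the factor [N ^ k]
   makes the matrix of [a] integral. *)
pose z (i : 'I_M) : R := (i %/ m)%:R + (a *+ N ^ k) *+ (i %% m).
have [w wE] := prod_factorial_dvd_Vandermonde z bin.
pose X (i j : 'I_M) : 'M[int]_d :=
  ((j %/ m)%N%:Z - (i %/ m)%N%:Z)%:M + ((j %% m)%N%:Z - (i %% m)%N%:Z) *: A.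
have rhoX i j : rho (z j - z i) = map_mx intr (X i j).
  rewrite map_mxD map_scalar_mx map_mxZ AE -scalemx1 scaler_nat !scaler_int.
  rewrite !mulrzBr -!pmulrn rmorphB !rmorphD !rmorphMn /= rmorph1.
  by rewrite opprD addrACA.
have X0 i j : i != j -> \det (X i j) != 0.
  move=> ne_ij; refine (eigenvalue_affine d0 Nk0 AE _ noeig).
  rewrite -negb_and !subr_eq0 !eqz_nat.
  apply: contra ne_ij => /andP[/eqP e1 /eqP e2].
  by apply/eqP/val_inj; rewrite /= (divn_eq i m) (divn_eq j m) e1 e2.
have X_le i j : (`|\det (X i j)| <= (E * m) ^ d)%N.
  have m0 : (0 < m)%N 
    by rewrite lt0n; apply/eqP=> m00; case: i => i; rewrite /M m00.
  apply: (@leq_trans (d`! * (c0.+1 * m) ^ d)%N).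
    apply: absz_det_le => u v; rewrite !mxE mulSn.
    have sub_le (p q : nat) : (p < m -> q < m -> `|p%:Z - q%:Z| <= m)%N by lia.
    apply: (@leq_trans (m + m * `|A u v|)%N); last first.
      by rewrite leq_add2l mulnC leq_mul2r c0P orbT.
    rewrite -lez_nat abszE PoszD PoszM.
    apply: le_trans (ler_normD _ _) _; rewrite normrM -!abszE.
    case: (_ == _); rewrite ?mulr1n ?mulr0n ?absz0;
      by rewrite lerD ?ler_wpM2r // lez_nat sub_le ?ltn_mod // ltn_divLR // -expn2.
  rewrite /E -mulnA [X in (_ <= X)%N]expnMn leq_mul2r; apply/orP; right.
  by rewrite -[X in (X <= _)%N]expn1 leq_pexp2l ?fact_gt0.
pose L := (\prod_(i < M) \prod_(j < M | (i < j)%N) `|\det (X i j)|)%N.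
have L0 : (0 < L)%N.
  apply: prodn_gt0 => i; apply: prodn_cond_gt0 => j lt_ij.
  by rewrite absz_gt0 X0 // -val_eqE /= neq_ltn lt_ij.
have L_le : (L <= ((E * m) ^ (\sum_(j < M) j)) ^ d)%N.
  apply: (@leq_trans (\prod_(i < M) \prod_(j < M | (i < j)%N) (E * m) ^ d)%N).
    by apply: leq_prod => i _; apply: leq_prod => j _.
  (* Each [j] is the larger index of exactly [j] pairs. *)
  rewrite (exchange_big_dep xpredT) //= expnAC expn_sum; apply: leq_prod => j _.
  by rewrite (big_ord_narrow (ltnW (ltn_ord j))) prod_nat_const card_ord.
have [t [W WE]] := int_rho w.
(* The multiplicative map [\det (rho _)] is applied to the Vandermonde identity; scalars of [R]
   contribute their [d]-th powers. *)
have : ((\prod_(j < M) j`!) ^ d %| N ^ (t * d) * L)%N.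
  have detM : {morph (fun r => \det (rho r)) : x y / x * y}.
    by move=> x y; rewrite rmorphM det_mulmx.
  have det1 : \det (rho 1) = 1 by rewrite rmorph1 det1.
  have := congr1 (fun r => \det (rho r)) wE.
  rewrite (big_morph _ detM det1) rmorphMn /= -scaler_nat detZ => detE.
  have {}detE : (\prod_(j < M) j`!)%:Z ^+ d * \det W =
      (N ^ t)%:Z ^+ d * \prod_(i < M) \prod_(j < M | (i < j)%N) \det (X i j).
    apply: (@intr_inj rat).
    rewrite 2!intrM -det_map_mx WE detZ !rmorphXn /= mulrCA; congr (_ * _).
    rewrite -[in LHS]pmulrn detE rmorph_prod; apply: eq_bigr => i _.
    rewrite (big_morph _ detM det1) rmorph_prod; apply: eq_bigr => j _.
    by rewrite rhoX det_map_mx.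
  apply/dvdnP; exists `|\det W|%N; move/(congr1 absz): detE.
  rewrite !abszM !abszX /= -expnM mulnC => ->; congr (_ * _)%N.
  rewrite (big_morph absz abszM (erefl _)); apply: eq_bigr => i _.
  by rewrite (big_morph absz abszM (erefl _)).
move=> /(superfactorial_exp_le N0 L0).
rewrite leqNgt => /negP; apply.
apply: (@leq_ltn_trans (((N * E * m) ^ (\sum_(j < M) j)) ^ d)).
  by rewrite -mulnA (expnMn N) (expnMn (N ^ _)) leq_mul2l L_le orbT.
by rewrite ltn_exp2r.
Qed.

(** The denominators of [U] and [V] enter only once, so a single modulus [N * N' ^ 2] serves all [A]
    simultaneously, as is required when a whole representation is restricted to a subspace. *)
Lemma integral_afterM N N' d d' (U : 'M[rat]_(d', d)) (V : 'M[rat]_(d, d'))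
    (A : 'M[rat]_d) U' V' :
    map_mx intr U' = N'%:R *: U -> map_mx intr V' = N'%:R *: V ->
  integral_after N A -> integral_after (N * N' ^ 2) (U *m A *m V).
Proof.
move=> eU eV [k [B eB]]; exists k.+1.
exists ((N * (N' ^ 2) ^ k)%:R *: (U' *m B *m V')).
rewrite map_mxZ !map_mxM eU eV eB !(=^~ scalemxAl, =^~ scalemxAr) !scalerA.
congr (_ *: _); rewrite rmorph_nat -!natrM; congr (_%:R).
rewrite expnMn !expnS; move: (N ^ k)%N ((N' * _) ^ k)%N => x y; ring.
Qed.

Lemma common_denominator m n (V : 'M[rat]_(m, n)) :
  exists2 D : nat, (0 < D)%N & exists B : 'M[int]_(m, n), map_mx intr B = D%:R *: V.
Proof.
pose D := \prod_i \prod_j denq (V i j).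
have D0 : 0 < D by do 2![apply: prodr_gt0 => ? _]; rewrite denq_gt0.
exists `|D|%N; first by rewrite absz_gt0 gt_eqF.
exists (\matrix_(i, j) (numq (V i j) * (D %/ denq (V i j))%Z)).
apply/matrixP=> i j; rewrite !mxE.
have dv : (denq (V i j) %| D)%Z.
  by rewrite /D (bigD1 i) //= (bigD1 j) //= -mulrA dvdz_mulr.
rewrite natr_absz ger0_norm ?ltW // -[in RHS](divzK dv) !intrM.
by rewrite numqE; ring.
Qed.

Lemma rootless_factor (F : fieldType) (f : {poly F}) : f != 0 ->
  exists s (g : {poly F}),
    f = (\prod_(x <- s) ('X - x%:P)) * g /\ forall c, ~~ root g c.
Proof.
elim: {f}(size f) {-2}f (leqnn (size f)) => [|n IHn] f le_f f0.
  by move: le_f f0; rewrite leqn0 size_poly_eq0 => ->.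
have [[c rc]|nr] := pselect (exists c, root f c); last first.
  exists [::], f; rewrite big_nil mul1r; split=> // c.
  by apply/negP => rc; apply: nr; exists c.
have /factor_theorem[q fE] := rc.
have q0 : q != 0 by apply: contraNneq f0 => q0; rewrite fE q0 mul0r.
have [|//|s [g [qE ng]]] := IHn q.
  by move: le_f; rewrite fE size_Mmonic ?monicXsubC // size_XsubC addn2.
by exists (c :: s), g; split=> //; rewrite big_cons fE qE mulrC mulrA.
Qed.

(** * Reducedness and diagonalizability *)

Section Diagonalizable.
Variables (R : comPzRingType) (d N : nat) (rho : {rmorphism R -> 'M[rat]_d.+1}).
Hypotheses (bin : has_binomials R) (N0 : (0 < N)%N) (inj : injective rho).
Hypothesis int_rho : forall r, integral_after N (rho r).

Lemma mulrn_rep_eq0 (r : R) n : (0 < n)%N -> r *+ n = 0 -> r = 0.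
Proof.
move=> n0 e; apply: inj; rewrite rmorph0; apply/eqP.
have := congr1 rho e; rewrite rmorphMn rmorph0 /= -scaler_nat => /eqP.
by rewrite scaler_eq0 pnatr_eq0 eqn0Ngt n0.
Qed.

(* When [a ^ 2 = 0], the binomial coefficient of [a] over [n] is [a / n] up to
   sign, so that [a] is divisible by every integer. *)
Lemma square_zero_divisible (a : R) n : a * a = 0 -> exists s, s *+ n.+1 = a.
Proof.
move=> aa; have [s sE] := bin a n.+1.
have prodE m : \prod_(i < m.+1) (a - i%:R) = (-1) ^+ m * a *+ m`!.
  elim: m => [|m IHm]; first by rewrite big_ord_recl big_ord0 mulr1 subr0 mul1r.
  rewrite big_ord_recr /= IHm mulrBr mulrnAl -mulrA aa mulr0 mul0rn sub0r.
  by rewrite mulr_natr -mulrnA factS mulnC exprS mulN1r mulNr mulNrn.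
exists ((-1) ^+ n * s).
apply/eqP; rewrite -subr_eq0; apply/eqP/(mulrn_rep_eq0 (fact_gt0 n)).
rewrite mulrnBl -mulrnA -factS -mulrnAr sE prodE mulrnAr mulrA -expr2 sqrr_sign.
by rewrite mul1r subrr.
Qed.

(** An entry of [rho a] is [u / N ^ k] with [u] an integer. As [a] is divisible by a prime
    [p > N + |u|], this prime divides [u] up to powers of [N], which forces [u = 0]. *)
Lemma square_zero_eq0 (a : R) : a * a = 0 -> a = 0.
Proof.
move=> aa; apply: inj; rewrite rmorph0; apply/matrixP=> i j; rewrite [RHS]mxE.
have [k [A AE]] := int_rho a.
have Nk0 n : (N ^ n)%:R != 0 :> rat by rewrite pnatr_eq0 -lt0n expn_gt0 N0.
pose u := A i j; have uE : u%:~R = (N ^ k)%:R * rho a i j.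
  by have := congr1 (fun B : 'M_d.+1 => B i j) AE; rewrite !mxE.
suff u0 : u = 0.
  by move/eqP: uE; rewrite u0 eq_sym mulf_eq0 (negPf (Nk0 k)) => /eqP.
have [p lt_p pr_p] := prime_above (N + `|u|).
have [s sE] := square_zero_divisible p.-1 aa.
rewrite prednK ?prime_gt0 // in sE.
have [l [B BE]] := int_rho s.
have vE : (B i j)%:~R = (N ^ l)%:R * rho s i j.
  by have := congr1 (fun B : 'M_d.+1 => B i j) BE; rewrite !mxE.
have e : (N ^ l)%:Z * u = p%:Z * ((N ^ k)%:Z * B i j).
  apply: (@intr_inj rat); rewrite !intrM uE vE -sE rmorphMn /= -scaler_nat mxE.
  by rewrite -!pmulrn; ring.
have : (p %| N ^ l * `|u|)%N.
  have /(congr1 absz) := e; rewrite !abszM /= => ->; exact: dvdn_mulr.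
rewrite Euclid_dvdM // => /orP[].
  rewrite Euclid_dvdX // => /andP[/(dvdn_leq N0) le_pN _].
  by have := leq_trans lt_p le_pN; rewrite ltnNge leq_addr.
have [//|u0] := eqVneq u 0; move=> /dvdn_leq; rewrite absz_gt0 => /(_ u0) le_pu.
by have := leq_trans lt_p le_pu; rewrite ltnNge leq_addl.
Qed.

Lemma nilpotent_eq0 (a : R) n : a ^+ n = 0 -> a = 0.
Proof.
move=> an; have : a ^+ (2 ^ n) = 0.
  by rewrite -(subnK (ltnW (ltn_expl n (isT : 1 < 2)%N))) exprD an mulr0.
elim: n {an} => [|n IHn]; first by rewrite expr1.
by rewrite expnS mulnC exprM expr2 => /square_zero_eq0.
Qed.

(** Integer polynomials in [rho a] come from [R], so reducedness of [R] applies to them. *)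
Lemma poly_rep (a : R) (P : {poly int}) :
  exists b, rho b = horner_mx (rho a) (map_poly intr P).
Proof.
elim/poly_ind: P => [|P c [b bE]]; first by exists 0; rewrite !rmorph0.
exists (b * a + c%:~R); rewrite rmorphD rmorphM /= bE rmorph_int.
rewrite !rmorphD !rmorphM /= map_polyX horner_mx_X map_polyC /= horner_mx_C.
by congr (_ + _); rewrite -scalemx1 scaler_int.
Qed.

(** The minimal polynomial is [h * g] with [h] split and [g] without rational roots. The kernel of
    [g(A)] is stable under [R]; were [g] not constant, [a] would have a rational eigenvalue on it,
    which is coprimality-excluded. Then a multiple of the squarefree part of [h], evaluated at [A],
    is nilpotent and comes from [R], hence vanishes. *)
Lemma rep_diagonalizable (a : R) : diagonalizable (rho a).
Proof.
apply/diagonalizableP; set A := rho a; set f := mxminpoly A.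
have f0 : f != 0 by rewrite monic_neq0 // mxminpoly_monic.
have [s [g [fE g_root]]] := rootless_factor f0.
set h := \prod_(x <- s) _ in fE.
have h0 : h != 0 by apply: contraNneq f0 => h0; rewrite fE h0 mul0r.
have g0 : g != 0 by apply: contraNneq f0 => g0; rewrite fE g0 mulr0.
have size_g : size g = 1%N.
  apply/eqP/negPn/negP => g1.
  pose U := kermxpoly A g; pose V := row_base U.
  have stabV r : stablemx V (rho r).
    rewrite stablemx_row_base comm_mx_stable_kermxpoly //.
    by rewrite /comm_mx -[_ *m _]rmorphM mulrC rmorphM.
  have freeV : row_free V by exact: row_base_free.
  (* If [g(A)] were invertible, [h(A)] would vanish, although [h] has smaller degree than the
     minimal polynomial. *)
  have rU : (0 < \rank U)%N.
    rewrite lt0n mxrank_eq0 kermx_eq0 row_free_unit; apply/negP => unit_g.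
    have : mxminpoly A %| h.
      apply: mxminpoly_min; apply: (mulIr unit_g); rewrite mul0r.
      by rewrite -rmorphM -fE; exact: mx_root_minpoly.
    move=> /dvdp_leq => /(_ h0); rewrite -/f fE size_mul //.
    have sh : (0 < size h)%N by rewrite size_poly_gt0.
    have sg : (1 < size g)%N by rewrite ltn_neqAle eq_sym g1 size_poly_gt0.
    by move: (size h) (size g) sh sg => p q; lia.
  have [D1 D10 [V' V'E]] := common_denominator V.
  have [D2 D20 [W' W'E]] := common_denominator (pinvmx V).
  have rep_add : zmod_morphism (fun r => conjmx V (rho r)).
    by move=> x y; rewrite rmorphB /conjmx mulmxBr mulmxBl.
  have rep_mul : monoid_morphism (fun r => conjmx V (rho r)).
    split; first by rewrite rmorph1 conjmx_scalar.
    by move=> x y; rewrite rmorphM conjmxM // inE stabV.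
  pose rho' : {rmorphism R -> 'M[rat]_(\rank U)} :=
    HB.pack (fun r => conjmx V (rho r))
      (GRing.isZmodMorphism.Build _ _ _ rep_add)
      (GRing.isMonoidMorphism.Build _ _ _ rep_mul).
  have D0 : (0 < N * (D1 * D2) ^ 2)%N.
    by rewrite muln_gt0 N0 expn_gt0 muln_gt0 D10 D20.
  have int_rho' r : integral_after (N * (D1 * D2) ^ 2) (rho' r).
    change (integral_after (N * (D1 * D2) ^ 2) (V *m rho r *m pinvmx V)).
    apply: (integral_afterM (U' := D2%:R *: V') (V' := D1%:R *: W')) (int_rho r).
      by rewrite map_mxZ V'E scalerA rmorph_nat mulnC natrM.
    by rewrite map_mxZ W'E scalerA rmorph_nat natrM.
  have [c] := exists_rational_eigenvalue bin rU D0 int_rho' a.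
  move=> /eigenvalueP[v /eigenspaceP v_eig v0].
  have vA : (v *m V <= eigenspace A c)%MS.
    by rewrite -sub_eigenspace_conjmx ?stabV //; exact: v_eig.
  have vU : (v *m V <= U)%MS by rewrite (submx_trans (submxMl _ _)) ?eq_row_base.
  have : (v *m V <= kermxpoly A g :&: kermxpoly A ('X - c%:P))%MS.
    by rewrite sub_capmx vU -eigenspace_poly.
  rewrite mxdirect_kermxpoly ?submx0; last first.
    by rewrite coprimep_XsubC g_root.
  by rewrite mulmx_free_eq0 // (negPf v0).
have fh : f %= h.
  by rewrite fE -[X in _ %= X]mulr1 eqp_mull // -size_poly_eq1 size_g.
exists (undup s); first exact: undup_uniq.
set h' := \prod_(x <- undup s) _.
have [P [q q0 PE]] := rat_poly_scale h'.
have [b bE] := poly_rep a P.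
have hP : map_poly intr P = q%:~R *: h'.
  by rewrite PE scalerA divff ?intr_eq0 // scale1r.
(* Every root of [h] is a root of [h'], so the power of [h'] with exponent [size s] is a multiple of
   [h]. *)
have bn : b ^+ (size s) = 0.
  apply: inj; rewrite rmorph0 rmorphXn /= bE hP.
  have /dvdpP[q' fq] : f %| h' ^+ size s.
    rewrite (eqp_dvdl _ fh) /h.
    have : {subset s <= s} by []; elim: {1 3 4}s => [|x t IHt] st.
      by rewrite big_nil dvd1p.
    rewrite big_cons exprS dvdp_mul ?IHt // => [|y ty]; last first.
      by rewrite st ?inE ?ty ?orbT.
    by rewrite dvdp_XsubCl root_prod_XsubC mem_undup st ?mem_head.
  rewrite linearZ /= exprZn -[_ ^+ _ in X in _ *: X]rmorphXn fq rmorphM /=.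
  by rewrite /f mx_root_minpoly mulr0 scaler0.
have b0 := nilpotent_eq0 bn.
apply: mxminpoly_min; have := bE; rewrite b0 rmorph0 hP linearZ /= => /esym/eqP.
by rewrite scaler_eq0 intr_eq0 (negPf q0) => /eqP.
Qed.

End Diagonalizable.

(** * Standard monomials *)

(** Induction on the number of coordinates. Let [s] serve for the first [n] coordinates and let [B]
    bound the last one on [s]. Elements with last coordinate at least [B] lie above [s]; the others
    fall into the [B] slices where it is constant, each covered by induction. *)
Lemma Dickson (T : eqType) (c : nat -> T -> nat) n (P : T -> Prop) :
  exists2 s : seq T, (forall x, x \in s -> P x) &
    forall x, P x -> exists2 y, y \in s & forall i, (i < n)%N -> (c i y <= c i x)%N.
Proof.
elim: n P => [|n IHn] P.
  have [[x Px]|nP] := pselect (exists x, P x).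
    by exists [:: x] => [y|y _]; [rewrite inE => /eqP-> | exists x; rewrite ?inE].
  by exists [::] => // x Px; case: nP; exists x.
have [s sP s_min] := IHn P.
pose B := \max_(x <- s) c n x.
suff [t tP t_min] : exists2 t : seq T, (forall x, x \in t -> P x) &
    forall x, P x -> (c n x < B)%N ->
    exists2 y, y \in t & forall i, (i < n.+1)%N -> (c i y <= c i x)%N.
  exists (s ++ t) => [x|x Px]; first by rewrite mem_cat => /orP[/sP|/tP].
  have [lt_xB|le_Bx] := ltnP (c n x) B.
    by have [y yt y_min] := t_min x Px lt_xB; exists y; rewrite ?mem_cat ?yt ?orbT.
  have [y ys y_min] := s_min x Px; exists y; rewrite ?mem_cat ?ys // => i.
  rewrite ltnS leq_eqVlt => /predU1P[->|/y_min//].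
  by apply: leq_trans le_Bx; rewrite /B (big_rem y) ?leq_maxl.
elim: B => [|B [t tP t_min]]; first by exists [::].
have [u uP u_min] := IHn (fun x => P x /\ c n x = B).
exists (t ++ u) => [x|x Px].
  by rewrite mem_cat => /orP[/tP|/uP[]].
rewrite ltnS leq_eqVlt => /predU1P[xB|/(t_min x Px)[y yt y_min]]; last first.
  by exists y; rewrite ?mem_cat ?yt.
have [y yu y_min] := u_min x (conj Px xB).
exists y; rewrite ?mem_cat ?yu ?orbT // => i.
rewrite ltnS leq_eqVlt => /predU1P[->|/y_min//].
by rewrite xB (uP y yu).2.
Qed.

Section StandardMonomials.
Variables (n : nat) (R : comNzRingType) (h : 'I_n -> R).
Hypothesis bin : has_binomials R.

Let ev : {mpoly int[n]} -> R := mmap intr h.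
Hypothesis ev_surj : forall x, exists P, ev P = x.
Implicit Types (m : 'X_{1..n}) (P Q : {mpoly int[n]}).

(** The leading monomials of the kernel of [ev], whatever their integer coefficients, which need not
    be units. *)
Definition leading m := exists P, [/\ P != 0, ev P = 0 & mlead P = m].
Definition standard P := forall m, m \in msupp P -> ~ leading m.

Lemma leading_le m m' : (m <= m')%MM -> leading m -> leading m'.
Proof.
move=> le_m [P [P0 eP Pm]]; rewrite -Pm in le_m.
have X0 k : 'X_[k] != 0 :> {mpoly int[n]} by rewrite -msupp_eq0 msuppX.
exists (P * 'X_[m' - mlead P]); split.
- by rewrite mulf_neq0.
- by rewrite /ev rmorphM /= -/ev eP mul0r.
- by rewrite mleadM // mleadXm addmC submK.
Qed.

Lemma standard_eq0 P : standard P -> ev P = 0 -> P = 0.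
Proof.
move=> stP eP; apply/eqP/negPn/negP => P0.
by apply: (stP (mlead P)); [exact: mlead_supp | exists P].
Qed.

Lemma standardD P Q : standard P -> standard Q -> standard (P + Q).
Proof.
by move=> sP sQ m /msuppD_le; rewrite mem_cat => /orP[/sP|/sQ].
Qed.

Lemma standardZ c P : standard P -> standard (c *: P).
Proof. by move=> sP m /msuppZ_le /sP. Qed.

Lemma standardX m : ~ leading m -> standard 'X_[m].
Proof. by move=> nl m'; rewrite msuppX inE => /eqP->. Qed.

(** Dickson's lemma for the exponents of leading monomials yields polynomials that form a Groebner
    basis once their leading coefficients are inverted. *)
Lemma leading_basis : exists2 s : seq {mpoly int[n]},
    forall P, P \in s -> P != 0 /\ ev P = 0 &
    forall m, leading m -> exists2 P, P \in s & (mlead P <= m)%MM.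
Proof.
pose c i P := if insub i is Some j then mlead P j else 0%N.
have [s sP s_min] := Dickson c n (fun P => P != 0 /\ ev P = 0).
exists s => // m [P [P0 eP <-]]; have [Q Qs le_QP] := s_min P (conj P0 eP).
exists Q => //; apply/mnm_lepP => i.
by have := le_QP i (ltn_ord i); rewrite /c valK.
Qed.

(** For [N > 0], the image of [r] in [R[1/N]] lies in the span over [Z[1/N]] of the standard
    monomials. *)
Definition reducible N (r : R) :=
  exists k Q, standard Q /\ ev Q = r *+ N ^ k.

Lemma reducibleD N r r' : reducible N r -> reducible N r' -> reducible N (r + r').
Proof.
move=> [k [Q [sQ eQ]]] [k' [Q' [sQ' eQ']]].
exists (k + k')%N, ((N ^ k')%:Z *: Q + (N ^ k)%:Z *: Q'); split.
  by apply: standardD; apply: standardZ.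
rewrite /ev rmorphD /= !mmapZ /= -/ev eQ eQ' -!pmulrn !mulr_natl -!mulrnA -!expnD.
by rewrite addnC mulrnDl.
Qed.

Lemma reducibleZ N r c : reducible N r -> reducible N (r *~ c).
Proof.
move=> [k [Q [sQ eQ]]]; exists k, (c *: Q); split; first exact: standardZ.
by rewrite /ev mmapZ /= -/ev eQ mulrzl pmulrn mulrzAC.
Qed.

Lemma reducible_sum N (I : eqType) (s : seq I) (F : I -> R) :
  (forall i, i \in s -> reducible N (F i)) -> reducible N (\sum_(i <- s) F i).
Proof.
move=> red; rewrite big_seq; elim/big_rec: _ => [|i x si redx].
  by exists 0%N, 0; split; [move=> m; rewrite msupp0 | rewrite /ev rmorph0 mul0rn].
by apply: reducibleD => //; apply: red.
Qed.

Lemma reducible_div N r (c : int) : (`|c| %| N)%N ->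
  reducible N (r *~ c) -> reducible N r.
Proof.
move=> /dvdnP[e eN] [k [Q [sQ eQ]]].
exists k.+1, ((e%:Z * sgz c) *: Q); split; first exact: standardZ.
rewrite /ev mmapZ /= -/ev eQ mulrzl !pmulrn -!mulrzA; congr (_ *~ _).
by rewrite expnS {2}eN !PoszM abszEsg; ring.
Qed.

(** [N] is the product of the leading coefficients of the basis. Along the well-founded monomial
    order, a leading monomial times such a coefficient is rewritten through smaller monomials. *)
Lemma monomials_reducible : exists2 N, (0 < N)%N & forall r, reducible N r.
Proof.
have [s sP s_min] := leading_basis.
pose N := (\prod_(P <- s) `|mleadc P|)%N; exists N.
  rewrite /N big_seq; apply: prodn_cond_gt0 => P /sP[P0 _].
  by rewrite absz_gt0 mleadc_eq0.
have redX m : reducible N (ev 'X_[m]).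
  elim/(@ltmwf n): m => m IH.
  have [lm|nlm] := pselect (leading m); last first.
    by exists 0%N, 'X_[m]; split; [exact: standardX | rewrite mulr1n].
  have [P Ps le_Pm] := s_min m lm; have [P0 eP] := sP P Ps.
  apply: (@reducible_div _ _ (mleadc P)); first by rewrite /N (big_rem P) ?dvdn_mulr.
  pose Q := P - mleadc P *: 'X_[mlead P].
  have -> : ev 'X_[m] *~ mleadc P = (ev ('X_[m - mlead P] * Q)) *~ (-1).
    rewrite /Q mulrBr -scalerAr -mpolyXD submK // /ev rmorphB rmorphM /= -/ev eP.
    by rewrite mulr0 sub0r [ev (_ *: _)]mmapZ /= mulrzl mulrN1z opprK.
  apply: reducibleZ; rewrite {1}(mpolyE Q) mulr_sumr /ev rmorph_sum /=.
  apply: reducible_sum => m' m'Q.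
  rewrite -scalerAr -mpolyXD mmapZ /= -/ev mulrzl; apply: reducibleZ; apply: IH.
  rewrite -{2}(submK le_Pm). rewrite ltmc_add2r.
  move: m'Q; rewrite (perm_mem (msupp_rem _ _)) mem_rem_uniq // inE => /andP[ne m'P].
  by rewrite lt_neqAle ne msupp_le_mlead.
move=> r; have [P <-] := ev_surj r; rewrite (mpolyE P) /ev rmorph_sum /=.
by apply: reducible_sum => m _; rewrite mmapZ /= mulrzl; apply: reducibleZ; apply: redX.
Qed.

(* With [p] prime and not dividing [N], the product
   [X^m (X_i - 0) ... (X_i - (p - 1))] has value in [p R] and leading term
   [X^(m + p U_i)]; reducing the quotient to standard form, the latter cannot be
   standard. *)
Lemma standard_exponent_lt N p m i : (forall r, reducible N r) ->
  prime p -> ~~ (p %| N)%N -> ~ leading m -> (m i < p)%N.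
Proof.
move=> redN pr_p pN nlm; rewrite ltnNge; apply/negP => le_pm.
pose mi j := (m - U_(i) *+ p + U_(i) *+ j)%MM.
pose F j : {mpoly int[n]} :=
  'X_[m - U_(i) *+ p] * \prod_(t < j) ('X_i - (t%:R : int)%:MP).
have le_U : (U_(i) *+ p <= m)%MM.
  apply/mnm_lepP => j; rewrite mulmnE mnm1E.
  by case: eqP => [<-|_]; rewrite ?mul1n ?mul0n.
(* The support is controlled by divisibility, not just by the monomial order: divisors of the
   nonleading [m] are nonleading, so [F p] is standard. *)
have FE j : (F j)@_(mi j) = 1 /\ forall m', m' \in msupp (F j) -> (m' <= mi j)%MM.
  elim: j => [|j [IHc IHs]].
    rewrite /F big_ord0 mulr1 /mi mulm0n addm0; split; first by rewrite mcoeffX eqxx.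
    by move=> m'; rewrite msuppX inE => /eqP->; exact: lepm_refl.
  have miS : mi j.+1 = (U_(i) + mi j)%MM 
    by apply/mnmP => k; rewrite /mi !mnmDE !mulmnE mulnS addnCA.
  have FS : F j.+1 = F j * 'X_i - j%:R *: F j.
    by rewrite /F big_ord_recr /= mulrA mulrBr [_ * _%:MP]mulrC mul_mpolyC.
  rewrite FS miS; split.
    rewrite mcoeffB mcoeffMX IHc mcoeffZ [X in _ * X]memN_msupp_eq0 ?mulr0 ?subr0 //.
    apply/negP => /IHs/mnm_lepP/(_ i).
    by rewrite mnmDE mnm1E eqxx ltnn.
  move=> m' /msuppB_le; rewrite mem_cat => /orP[|/msuppZ_le/IHs le_m'].
    rewrite (perm_mem (msuppMX _ _)) => /mapP[m'' /IHs/mnm_lepP le_m'' ->].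
    by apply/mnm_lepP => k; rewrite mnmDE [X in (_ <= X)%N]mnmDE leq_add2l le_m''.
  by apply: (lepm_trans le_m'); exact: lem_addl.
have mip : mi p = m by rewrite /mi submK.
have [Fm Fs] := FE p; rewrite mip in Fm Fs.
have [s sE] := bin (h i) p.
(* Of [p!] only the factor [p] is left outside the element being reduced. *)
have [k [Q [sQ eQ]]] := redN (ev 'X_[m - U_(i) *+ p] * s *+ p.-1`!).
have eF : ev (F p) *+ N ^ k = ev Q *+ p.
  have -> : ev (F p) = ev 'X_[m - U_(i) *+ p] * \prod_(t < p) (h i - t%:R).
    rewrite /F /ev rmorphM rmorph_prod /=; congr (_ * _); apply: eq_bigr => t _.
    by rewrite rmorphB /= mmapX mmap1U mmapC /= rmorph_nat.
  rewrite -sE eQ mulrnAr -!mulrnA; congr (_ *+ _).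
  by rewrite -{1}(prednK (prime_gt0 pr_p)) factS (prednK (prime_gt0 pr_p)); ring.
(* A standard polynomial in the kernel vanishes; its coefficient at [m] then gives [p %| N ^ k]. *)
have : (N ^ k)%:R *: F p - p%:R *: Q = 0.
  apply: standard_eq0.
    rewrite -scaleNr; apply: standardD; apply: standardZ => // m' /Fs le_m'.
    by apply: contra_not nlm; exact: leading_le.
  by rewrite /ev rmorphB /= !mmapZ /= !rmorph_nat !mulr_natl -/ev eF subrr.
move=> /(congr1 (mcoeff m)); rewrite mcoeffB !mcoeffZ Fm mcoeff0 mulr1 => /eqP.
rewrite subr_eq0 => /eqP/(congr1 absz); rewrite abszM !natz /= => e.
have : (p %| N ^ k)%N by rewrite e dvdn_mulr.
by rewrite Euclid_dvdX // (negPf pN).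
Qed.

Lemma integral_basis_up_to_nz : exists d (b : 'I_d -> R) N,
  [/\ (0 < N)%N,
      forall c : 'I_d -> int, \sum_i b i *~ c i = 0 -> forall i, c i = 0 &
      forall r, exists k (c : 'I_d -> int), r *+ N ^ k = \sum_i b i *~ c i].
Proof.
have [N N0 redN] := monomials_reducible.
have [p lt_Np pr_p] := prime_above N.
have pN : ~~ (p %| N)%N by apply/negP => /(dvdn_leq N0); rewrite leqNgt lt_Np.
(* All exponents of a standard monomial are below [p], so the degree bound [n * p] misses none. *)
pose B := [seq m <- [seq val m | m : 'X_{1..n < (n * p).+1}] | ~~ `[<leading m>]].
have B_uniq : uniq B.
  by rewrite filter_uniq // map_inj_uniq ?enum_uniq //; exact: val_inj.
have inB m : m \in B <-> ~ leading m.
  rewrite mem_filter; split=> [/andP[/asboolPn //]|nlm].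
  apply/andP; split; first exact/asboolPn.
  have deg_m : (mdeg m < (n * p).+1)%N.
    rewrite ltnS mdegE -[n in (n * p)%N]card_ord -sum_nat_const.
    by apply: leq_sum => i _; apply: ltnW; apply: standard_exponent_lt redN _ _ _.
  by apply/mapP; exists (BMultinom deg_m); rewrite ?mem_enum.
pose b (i : 'I_(size B)) := ev 'X_[nth 0%MM B i].
exists (size B), b, N; split=> //.
  move=> c c0 i.
  pose Q := \sum_j c j *: 'X_[nth 0%MM B j].
  have : Q = 0.
    apply: standard_eq0.
      rewrite /Q; elim/big_rec: _ => [m|j P _ sP]; first by rewrite msupp0.
      by apply: standardD => //; apply/standardZ/standardX/inB/mem_nth.
    rewrite /Q /ev rmorph_sum -[RHS]c0; apply: eq_bigr => j _.
    by rewrite /= mmapZ /= mulrzl.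
  move=> /(congr1 (mcoeff (nth 0%MM B i))); rewrite mcoeff0 raddf_sum /=.
  rewrite (bigD1 i) //= mcoeffZ mcoeffX eqxx mulr1 big1 ?addr0 // => j ne_ji.
  by rewrite mcoeffZ mcoeffX nth_uniq // val_eqE (negPf ne_ji) mulr0.
move=> r; have [k [Q [sQ eQ]]] := redN r.
exists k, (fun i => Q@_(nth 0%MM B i)); rewrite -eQ {1}(mpolyE Q).
have permQ : perm_eq (msupp Q) [seq m <- B | m \in msupp Q].
  apply: uniq_perm (msupp_uniq _) (filter_uniq _ B_uniq) _ => m.
  by rewrite mem_filter; case: (boolP (m \in _)) => //= /sQ/inB->.
rewrite (perm_big _ permQ) big_filter big_mkcond /= (big_nth 0%MM) big_mkord.
rewrite /ev rmorph_sum /=.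
apply: eq_bigr => i _; case: ifPn => [_|/memN_msupp_eq0->].
  by rewrite mmapZ /= mulrzl.
by rewrite rmorph0 mulr0z.
Qed.

End StandardMonomials.

(** * Representation by matrices *)

Section RegularRepresentation.
Variables (R : comPzRingType) (d N : nat) (b : 'I_d -> R).
Hypotheses (tf : torsion_free R) (N0 : (0 < N)%N).
Hypothesis indep : forall c : 'I_d -> int, \sum_i b i *~ c i = 0 -> forall i, c i = 0.
Hypothesis gen :
  forall r, exists k (c : 'I_d -> int), r *+ N ^ k = \sum_i b i *~ c i.

Lemma mulrn_pow_eq0 (r : R) k : r *+ N ^ k = 0 -> r = 0.
Proof.
rewrite pmulrn => /tf[/eqP|//].
by rewrite eqz_nat expn_eq0 (gtn_eqF N0).
Qed.

Lemma pow_neq0 k : (N ^ k)%:R != 0 :> rat.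
Proof. by rewrite pnatr_eq0 expn_eq0 (gtn_eqF N0). Qed.

Lemma coordinates_exist r :
  exists kc : nat * ('I_d -> int), r *+ N ^ kc.1 = \sum_i b i *~ kc.2 i.
Proof. by have [k [c e]] := gen r; exists (k, c). Qed.

(** Coordinates in the basis [b] of [Q (x) R], read off from a chosen presentation; [coordE] shows
    that the choice is immaterial. *)
Definition coord (r : R) : 'rV[rat]_d :=
  let kc := sval (cid (coordinates_exist r)) in
  \row_i ((kc.2 i)%:~R / (N ^ kc.1)%:R).

Lemma coordE r k c : r *+ N ^ k = \sum_i b i *~ c i ->
  forall i, (N ^ k)%:R * coord r 0 i = (c i)%:~R.
Proof.
rewrite /coord => e i; rewrite mxE; case: cid => -[k' c'] /= e'.
apply: (mulIf (pow_neq0 k')).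
rewrite mulrA divfK ?pow_neq0 // !pmulrn -!intrM.
suff /indep/(_ i)/eqP : \sum_i b i *~ ((N ^ k)%:Z * c' i - c i * (N ^ k')%:Z) = 0.
  by rewrite subr_eq0 => /eqP->.
under eq_bigr => j _ do rewrite mulrzBr [_%:Z * _]mulrC !mulrzA -!pmulrn.
by rewrite sumrB !sumrMnl -e -e' mulrnAC subrr.
Qed.

Lemma coord_zmod_morphism : zmod_morphism coord.
Proof.
move=> r s; have [k [c e]] := gen r; have [l [c' e']] := gen s.
have coordB i : (coord r - coord s) 0 i = coord r 0 i - coord s 0 i by rewrite !mxE.
apply/rowP => i; rewrite coordB; apply: (mulfI (pow_neq0 (k + l))).
pose c2 i := c i * (N ^ l)%:Z - c' i * (N ^ k)%:Z.
rewrite (@coordE _ _ c2) => [|]; last first.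
  under eq_bigr => j _ do rewrite mulrzBr !mulrzA -!pmulrn.
  by rewrite sumrB !sumrMnl -e -e' -!mulrnA -!expnD addnC mulrnBl.
rewrite expnD natrM mulrBr mulrAC (coordE e) -mulrA (coordE e').
by rewrite /c2 rmorphB !rmorphM /= [X in _ - X]mulrC.
Qed.

HB.instance Definition _ :=
  GRing.isZmodMorphism.Build R 'rV[rat]_d coord coord_zmod_morphism.

Lemma coord_eq0 r : coord r = 0 -> r = 0.
Proof.
have [k [c e]] := gen r => r0; apply: (@mulrn_pow_eq0 _ k).
rewrite e big1 // => i _; have /eqP := coordE e i.
by rewrite r0 mxE mulr0 eq_sym intr_eq0 => /eqP->.
Qed.

Lemma coord_basis i : coord (b i) = delta_mx 0 i.
Proof.
have e : b i *+ N ^ 0 = \sum_j b j *~ (j == i)%:Z.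
  rewrite (bigD1 i) //= eqxx big1 ?addr0 // => l ne_li.
  by rewrite (negPf ne_li) mulr0z.
apply/rowP => j; rewrite [RHS]mxE eqxx /= -[LHS]mul1r (coordE e).
by case: eqP.
Qed.

Definition regular_rep (r : R) : 'M[rat]_d := \matrix_i coord (r * b i).

Lemma regular_rep_zmod_morphism : zmod_morphism regular_rep.
Proof. by move=> r s; apply/row_matrixP => i; rewrite linearB /= !rowK mulrBl raddfB. Qed.

Lemma regular_rep_monoid_morphism : monoid_morphism regular_rep.
Proof.
split=> [|r s]; apply/row_matrixP => i; rewrite !rowK.
  by rewrite mul1r coord_basis rowE mulmx1.
rewrite row_mul rowK.
have [k [c e]] := gen (r * b i).
apply: (scalerI (pow_neq0 k)); rewrite scaler_nat -raddfMn /=.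
rewrite mulrAC -mulrnAl e mulr_suml raddf_sum /= scalemxAl mulmx_sum_row.
apply: eq_bigr => j _; rewrite rowK mxE (coordE e) scaler_int -raddfMz.
by rewrite /= mulrzAl mulrC.
Qed.

HB.instance Definition _ :=
  GRing.isZmodMorphism.Build R 'M[rat]_d regular_rep regular_rep_zmod_morphism.
HB.instance Definition _ :=
  GRing.isMonoidMorphism.Build R 'M[rat]_d regular_rep regular_rep_monoid_morphism.

Definition regular_rmorphism : {rmorphism R -> 'M[rat]_d} := regular_rep.

(** An element acting as zero kills every [b i], hence also some [N ^ k] times [1], and [R] is
    torsion-free. *)
Lemma regular_rep_inj : injective regular_rmorphism.
Proof.
apply: raddf_inj => r r0.
have rb i : r * b i = 0.
  apply: coord_eq0; rewrite -[LHS](rowK (fun i => coord (r * b i))).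
  by rewrite -/(regular_rep r) r0 row0.
have [k [c e]] := gen 1; apply: (@mulrn_pow_eq0 _ k).
rewrite -[r]mulr1 -mulrnAr e mulr_sumr big1 // => i _.
by rewrite mulrzAr rb mul0rz.
Qed.

Lemma regular_rep_integral r : integral_after N (regular_rmorphism r).
Proof.
pose k i := sval (cid (gen (r * b i))).
have kP i : exists c : 'I_d -> int, r * b i *+ N ^ k i = \sum_j b j *~ c j.
  by rewrite /k; case: cid.
pose c i := sval (cid (kP i)); pose K := (\sum_i k i)%N.
exists K, (\matrix_(i, j) ((N ^ (K - k i))%:Z * c i j)).
apply/matrixP => i j; rewrite mxE [X in X%:~R]mxE [RHS]mxE.
have -> : regular_rep r i j = coord (r * b i) 0 j by rewrite !mxE.
have e : r * b i *+ N ^ k i = \sum_j b j *~ c i j by rewrite /c; case: cid.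
rewrite intrM -(coordE e) mulrA -pmulrn -natrM -expnD subnK //.
by rewrite /K (bigD1 i) //= leq_addr.
Qed.

End RegularRepresentation.

Lemma integral_basis_up_to (R : comPzRingType) :
    has_binomials R -> finitely_generated_ring R ->
  exists d (b : 'I_d -> R) N,
  [/\ (0 < N)%N,
      forall c : 'I_d -> int, \sum_i b i *~ c i = 0 -> forall i, c i = 0 &
      forall r, exists k (c : 'I_d -> int), r *+ N ^ k = \sum_i b i *~ c i].
Proof.
have [e10|nz] := eqVneq (1 : R) 0.
  move=> _ _; exists 0%N, (fun=> 0), 1%N; split=> // [c _ []//|r].
  by exists 0%N, (fun=> 0); rewrite big_ord0 mulr1n -[r]mulr1 e10 mulr0.
pattern R; refine (nonzero_ringW _ nz) => S bin [gs gsP].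
pose h (i : 'I_(size gs)) := nth 0 gs i.
pose ev : {rmorphism {mpoly int[size gs]} -> S} := mmap intr h.
apply: (@integral_basis_up_to_nz _ _ h) => // x.
apply/asboolP; move: x.
apply: (gsP (fun x => `[<exists P, ev P = x>])).
  split.
  - by apply/asboolP; exists 1; rewrite rmorph1.
  - move=> x y /asboolP[P <-] /asboolP[Q <-]; apply/asboolP.
    by exists (P - Q); rewrite rmorphB.
  - move=> x y /asboolP[P <-] /asboolP[Q <-]; apply/asboolP.
    by exists (P * Q); rewrite rmorphM.
move=> g g_gs; apply/asboolP.
have lt_g : (index g gs < size gs)%N by rewrite index_mem.
exists 'X_(Ordinal lt_g).
by rewrite /ev /= mmapX mmap1U /h /= nth_index.
Qed.

(** The generators act by commuting diagonalizable matrices, so one base change makes them all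
    diagonal. The elements with diagonal image form a subring, hence all of [R], and the characters
    are the diagonal entries. *)
Lemma joint_characters (R : comPzRingType) :
    torsion_free R -> has_binomials R -> finitely_generated_ring R ->
  exists d (chi : 'I_d -> {rmorphism R -> rat}),
    forall r, (forall i, chi i r = 0) -> r = 0.
Proof.
move=> tf bin fg; have [d [b [N [N0 indep gen]]]] := integral_basis_up_to bin fg.
pose rho : {rmorphism R -> 'M[rat]_d} := regular_rmorphism N0 indep gen.
have rho_inj : injective rho by exact: regular_rep_inj tf _ _ _.
have int_rho r : integral_after N (rho r) by exact: regular_rep_integral.
(* In dimension [0] injectivity makes [R] the zero ring, and the empty family of characters
   works. *)
move: rho rho_inj int_rho => {b indep gen}; case: d => [|d] rho rho_inj int_rho.
  exists 0%N, (fun i : 'I_0 => False_rect _ (notF (ltn_ord i))) => r _.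
  by apply: rho_inj; apply/matrixP=> -[].
have [gs gsP] := fg.
have /codiagonalizableP[P unitP /allP diagP] :
    {in [seq rho g | g <- gs] &, forall f g, comm_mx f g} /\
    forall f, f \in [seq rho g | g <- gs] -> diagonalizable f.
  split=> [_ _ /mapP[x _ ->] /mapP[y _ ->]|_ /mapP[x _ ->]].
    by rewrite /comm_mx -[_ *m _]rmorphM mulrC rmorphM.
  exact: (rep_diagonalizable bin N0).
pose D r := P *m rho r *m invmx P.
have DB x y : D (x - y) = D x - D y by rewrite /D rmorphB mulmxBr mulmxBl.
have DM x y : D (x * y) = D x *m D y by rewrite /D rmorphM !mulmxA mulmxKV.
have D1 : D 1 = 1%:M by rewrite /D rmorph1 mulmx1 mulmxV.
have diagD r : is_diag_mx (D r).
  apply: (gsP (fun r => is_diag_mx (D r))).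
    split.
    - by rewrite unfold_in D1 scalar_mx_is_diag.
    - move=> x y /diag_mxP[u eu] /diag_mxP[v ev].
      by apply/diag_mxP; exists (u - v); rewrite DB eu ev linearB.
    - move=> x y /diag_mxP[u eu] /diag_mxP[v ev].
      by apply/diag_mxP; rewrite DM eu ev mulmx_diag; eexists.
  move=> g g_gs; have := diagP (rho g) (map_f _ g_gs).
  by rewrite /= /similar_to /= conjumx.
have chi_add i : zmod_morphism (fun r => D r i i) by move=> x y; rewrite DB !mxE.
have chi_mul i : monoid_morphism (fun r => D r i i).
  split=> [|x y]; first by rewrite D1 mxE eqxx.
  rewrite DM mxE (bigD1 i) //= big1 ?addr0 // => j ne_ji.
  by have /is_diag_mxP -> := diagD x; rewrite ?mul0r // eq_sym.
pose chi i : {rmorphism R -> rat} := HB.pack (fun r => D r i i)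
  (GRing.isZmodMorphism.Build _ _ _ (chi_add i))
  (GRing.isMonoidMorphism.Build _ _ _ (chi_mul i)).
exists d.+1, chi => r r0.
have Dr : D r = 0.
  apply/matrixP => i j; rewrite [RHS]mxE.
  have [<-|ne_ij] := eqVneq i j; first exact: r0.
  by have /is_diag_mxP -> := diagD r.
apply: rho_inj; rewrite rmorph0.
have := congr1 (fun A => invmx P *m A *m P) Dr.
by rewrite /D -!mulmxA mulVmx // mulmx1 mulKmx // mul0mx mulmx0.
Qed.

(** * Splitting into subrings of the rationals *)

Lemma logn_prod_primes p s : uniq s -> all prime s ->
  logn p (\prod_(q <- s) q)%N = (p \in s) :> nat.
Proof.
elim: s => [|q s IHs] /=; first by rewrite big_nil logn1.
move=> /andP[qs us] /andP[pr_q pr_s].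
have s0 : (0 < \prod_(r <- s) r)%N.
  rewrite big_seq; apply: prodn_cond_gt0 => r /(allP pr_s); exact: prime_gt0.
rewrite big_cons lognM ?(prime_gt0 pr_q) // (logn_prime _ pr_q) IHs // inE.
by case: eqVneq => // ->; rewrite (negPf qs).
Qed.

(** [m] is the product of the primes dividing [D]; the exponent [D] is large enough since
    [logn p D < p ^ logn p D <= D]. *)
Lemma exists_squarefree_radical D : (0 < D)%N ->
  exists m, [/\ positive_squarefree m, (m %| D)%N & (D %| m ^ D)%N].
Proof.
move=> D0; pose m := (\prod_(p <- primes D) p)%N; exists m.
have all_pr : all prime (primes D) := all_prime_primes D.
have lognm p : logn p m = (p \in primes D) by rewrite logn_prod_primes ?primes_uniq.
have m0 : (0 < m)%N.
  rewrite /m big_seq; apply: prodn_cond_gt0 => p /(allP all_pr); exact: prime_gt0.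
split.
- split=> // d dm; apply/eqP/negPn/negP => d1.
  have d0 : (0 < d)%N by case: d dm {d1} => //; rewrite dvd0n (gtn_eqF m0).
  have pr_p : prime (pdiv d) by rewrite pdiv_prime // ltn_neqAle eq_sym d1.
  have : (pdiv d ^ 2 %| m)%N by apply: dvdn_trans dm; rewrite dvdn_exp2r ?pdiv_dvd.
  by rewrite pfactor_dvdn // lognm; case: (_ \in _).
- apply/dvdn_partP => // p _; rewrite p_part lognm.
  by case: (boolP (p \in _)); rewrite // mem_primes => /and3P[].
- apply/dvdn_partP => // p pD; rewrite p_part.
  apply: (@dvdn_trans (m ^ logn p D)); last first.
    rewrite dvdn_exp2l // ltnW //; apply: leq_trans (dvdn_leq D0 (pfactor_dvdnn p D)).
    by rewrite ltn_expl // prime_gt1 //; move: pD; rewrite mem_primes => /and3P[].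
  by apply: dvdn_exp2r; rewrite /m (big_rem p) // dvdn_mulr.
Qed.

Lemma squarefree_dvd_exp m n k :
  positive_squarefree m -> (m %| n ^ k)%N -> (m %| n)%N.
Proof.
move=> [m0 sqf] dv; apply/dvdn_partP => // p pm; rewrite p_part.
have [pr_p pdm] : prime p /\ (p %| m)%N by move: pm; rewrite mem_primes => /and3P[].
have le1 : (logn p m <= 1)%N.
  rewrite leqNgt -pfactor_dvdn //; apply/negP => /sqf p1.
  by rewrite p1 in pr_p.
have pn : (p %| n)%N.
  by have := dvdn_trans pdm dv; rewrite Euclid_dvdX // => /andP[].
by apply: dvdn_trans (dvdn_exp2l p le1) _; rewrite expn1.
Qed.

Lemma Zinv_integral m q : (0 < m)%N -> q \in Zinv_pred m ->
  exists k (z : int), q * (m ^ k)%:R = z%:~R.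
Proof.
move=> m0 /asboolP[p ->]; have mN0 : m%:R != 0 :> rat by rewrite pnatr_eq0 -lt0n.
elim/poly_ind: p => [|p c [k [z e]]].
  by exists 0%N, 0; rewrite rmorph0 horner0 mul0r.
exists k.+1, (z + c * (m ^ k.+1)%:Z).
rewrite rmorphD rmorphM /= map_polyX map_polyC /= !hornerE mulrDl.
rewrite rmorphD rmorphM /= -e -!pmulrn; congr (_ + _).
by rewrite expnSr natrM mulrACA mulVf // mulr1.
Qed.

(** From [1/m] in [Z[1/n]] it follows that [m] divides a power of [n]. *)
Lemma Zinv_dvd m n : positive_squarefree m -> (0 < n)%N ->
  {subset Zinv_pred m <= Zinv_pred n} -> (m %| n)%N.
Proof.
move=> sqf n0 sub; have m0 : m%:R != 0 :> rat by rewrite pnatr_eq0 -lt0n; case: sqf.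
have [|k [z e]] := @Zinv_integral n m%:R^-1 n0.
  by apply: sub; apply/asboolP; exists 'X; rewrite map_polyX hornerX.
apply: (@squarefree_dvd_exp _ _ k) => //.
have /(@intr_inj rat)/(congr1 absz) : (n ^ k)%:Z%:~R = (m%:Z * z)%:~R :> rat.
  by rewrite intrM -e -!pmulrn mulVKf.
by rewrite abszM /= => ->; rewrite dvdn_mulr.
Qed.

Lemma Zinv_eq m n : positive_squarefree m -> positive_squarefree n ->
  Zinv_pred m =i Zinv_pred n -> m = n.
Proof.
move=> sm sn e; apply/eqP; rewrite eqn_dvd.
by rewrite !Zinv_dvd ?(sm.1, sn.1) // => q; rewrite e.
Qed.

(** [m] is the radical of the product [D] of the denominators of the generators. The image lies in
    [Z[1/m]] and contains [1/D], hence [1/m]. *)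
Lemma character_image (R : comPzRingType) (chi : {rmorphism R -> rat}) :
    finitely_generated_ring R ->
  exists2 m, positive_squarefree m &
    forall q, q \in Zinv_pred m <-> exists r, chi r = q.
Proof.
move=> [gs gsP]; pose D := (\prod_(g <- gs) `|denq (chi g)|)%N.
have D0 : (0 < D)%N by apply: prodn_gt0 => g; rewrite absz_gt0.
have [m [sqf mD Dm]] := exists_squarefree_radical D0.
have m0 : (0 < m)%N by case: sqf.
have mN0 : m%:R != 0 :> rat by rewrite pnatr_eq0 -lt0n.
have nz (n : nat) : (0 < n)%N -> n%:R != 0 :> rat by rewrite pnatr_eq0 -lt0n.
have denqE x : (`|denq x|%N)%:R = (denq x)%:~R :> rat by rewrite pmulrn absz_denq.
exists m => // q; split; last first.
  case=> r <-; pose S : {pred R} := fun r => chi r \in Zinv_pred m.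
  have SE x : (x \in S) = (chi x \in Zinv_pred m) by [].
  rewrite -SE; apply: gsP.
    split=> [|x y|x y]; rewrite !SE; first by rewrite rmorph1 rpred1.
      by move=> hx hy; rewrite rmorphB rpredB.
    by move=> hx hy; rewrite rmorphM rpredM.
  move=> g g_gs; rewrite SE.
  have [c cE] : exists c, (m ^ D = c * `|denq (chi g)|)%N.
    by apply/dvdnP; apply: dvdn_trans Dm; rewrite /D (big_rem g) // dvdn_mulr.
  have -> : chi g = (numq (chi g) * c%:Z)%:~R * m%:R^-1 ^+ D.
    have mD0 : (0 < m ^ D)%N by rewrite expn_gt0 m0.
    apply: (mulIf (nz _ mD0)).
    rewrite -mulrA exprVn -natrX mulVf ?nz // mulr1 intrM.
    by rewrite cE natrM denqE -pmulrn numqE; ring.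
  rewrite rpredM ?rpred_int // rpredX //.
  by apply/asboolP; exists 'X; rewrite map_polyX hornerX.
have [u chi_u] : exists u, chi u = D%:R^-1.
  rewrite /D; elim: (gs) => [|g s [u IHu]].
    by exists 1; rewrite big_nil rmorph1 invr1.
  (* A Bezout relation for numerator and denominator of [chi g] exhibits the inverse of the
     denominator as [a * chi g + c]. *)
  have /coprimezP[[a c] /= ac] : coprimez (numq (chi g)) (denq (chi g)).
    exact: coprime_num_den.
  exists ((g *~ a + c%:~R) * u).
  rewrite rmorphM IHu big_cons natrM invfM denqE; congr (_ * _).
  have d0 : (denq (chi g))%:~R != 0 :> rat by rewrite intr_eq0.
  apply: (mulIf d0); rewrite mulVf // rmorphD rmorphMz rmorph_int /= -mulrzl.
  by rewrite -[RHS]/(1%:~R) -ac rmorphD !rmorphM /= numqE; ring.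
have [v chi_v] : exists v, chi v = m%:R^-1.
  have /dvdnP[c cE] := mD; exists (u *+ c).
  rewrite rmorphMn /= chi_u -mulr_natl cE natrM invfM mulrA divff ?mul1r //.
  by apply: nz; move: D0; rewrite cE muln_gt0 => /andP[].
move=> /asboolP[p ->]; elim/poly_ind: p => [|p c [r rE]].
  by exists 0; rewrite !rmorph0 horner0.
exists (r * v + c%:~R).
by rewrite !rmorphD !rmorphM /= rmorph_int rE chi_v map_polyX map_polyC !hornerE.
Qed.

(** * Distinct characters and their idempotents *)

Lemma distinct_joint_characters (R : comPzRingType) d
    (chi : 'I_d -> {rmorphism R -> rat}) :
    (forall r, (forall i, chi i r = 0) -> r = 0) ->
  exists k (psi : 'I_k -> {rmorphism R -> rat}),
    (forall r, (forall i, psi i r = 0) -> r = 0) /\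
    forall i j, i != j -> exists a, psi i a != psi j a.
Proof.
elim: d chi => [|d IHd] chi inj; first by exists 0%N, chi; split=> // -[].
have [[i [j [ne_ij eq_ij]]]|sep] :=
  pselect (exists i j, i != j /\ forall a, chi i a = chi j a); last first.
  exists d.+1, chi; split=> // i j ne_ij; apply: contrapT => eq_ij; apply: sep.
  exists i, j; split=> // a; apply/eqP/negPn/negP => ne; apply: eq_ij.
  by exists a.
apply: (IHd (fun l => chi (lift i l))) => r r0; apply: inj => l.
case: (unliftP i l) => [l' ->|->]; first exact: r0.
by rewrite eq_ij; case: (unliftP i j) => [j' ->|e]; [apply: r0 | rewrite e eqxx in ne_ij].
Qed.

Lemma indicator_of_separation (R : comPzRingType) k
    (chi : 'I_k -> {rmorphism R -> rat}) :
    has_binomials R ->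
    (forall i j, i != j -> exists a, chi i a != chi j a) ->
  exists e, forall i j, chi i (e j) = (i == j)%:R.
Proof.
move=> bin sep.
suff H j : exists e, forall i, chi i e = (i == j)%:R.
  by exists (fun j => sval (cid (H j))) => i j; case: cid.
(* A separating [a] is scaled by the denominator of [chi i a] and shifted by its numerator. *)
have sep0 i : exists a, i != j -> chi j a != 0 /\ chi i a = 0.
  have [->|ne_ij] := eqVneq i j; first by exists 0.
  have [a ne_a] := sep i j ne_ij.
  exists (a *~ denq (chi i a) - (numq (chi i a))%:~R) => _.
  rewrite !rmorphB !rmorphMz !rmorph1 /= numqE -![chi _ a *~ _]mulrzr subrr.
  rewrite -mulrBl; split=> //.
  by rewrite mulf_neq0 ?intr_eq0 ?denq_eq0 // subr_eq0 eq_sym.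
pose b := \prod_(i | i != j) sval (cid (sep0 i)).
have bj : chi j b != 0.
  rewrite /b rmorph_prod /=; apply/prodf_neq0 => i ne_ij.
  by case: cid => a /= /(_ ne_ij)[].
have bi i : i != j -> chi i b = 0.
  move=> ne_ij; rewrite /b (bigD1 i) //= rmorphM /=.
  by case: cid => a /= /(_ ne_ij)[_ ->]; rewrite mul0r.
(* Clearing the denominator of [chi j b] and squaring turn the value at [j] into a positive integer.
   Positivity makes the binomial coefficient of [0] over [D] vanish. *)
pose D := (`|numq (chi j b)| ^ 2)%N.
pose b' := (b *~ denq (chi j b)) ^+ 2.
have b'j : chi j b' = D%:R.
  rewrite /b' rmorphXn rmorphMz /= -mulrzr -numqE /D -rmorphXn /= pmulrn.
  by congr (_%:~R); rewrite expnS expn1 PoszM -expr2 abszE real_normK ?num_real.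
have b'i i : i != j -> chi i b' = 0.
  by move=> ne_ij; rewrite /b' rmorphXn rmorphMz /= (bi i ne_ij) mul0rz expr0n.
have D0 : (0 < D)%N by rewrite expn_gt0 absz_gt0 numq_eq0 bj.
have [s sE] := bin b' D.
have DfN0 : D`!%:R != 0 :> rat by rewrite pnatr_eq0 -lt0n fact_gt0.
exists s => i; apply: (mulIf DfN0); rewrite mulr_natr -rmorphMn /= sE rmorph_prod.
have [->|ne_ij] := eqVneq i j.
  rewrite mul1r -ffactnn ffact_prod natr_prod; apply: eq_bigr => t _.
  by rewrite rmorphB rmorph_nat /= b'j natrB // ltnW.
rewrite mul0r; case: (D) D0 => // D' _; rewrite big_ord_recl.
by rewrite rmorphB b'i // rmorph_nat subrr mul0r.
Qed.

(* An intrinsic form of an isomorphism from [R] to the product of the rings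
   [Z[m_i^-1]]. *)
Definition splits_as (R : comPzRingType) k (chi : 'I_k -> {rmorphism R -> rat})
    (m : k.-tuple nat) : Prop :=
  [/\ forall r, (forall i, chi i r = 0) -> r = 0,
      exists e, forall i j, chi i (e j) = (i == j)%:R &
      forall i q, q \in Zinv_pred (tnth m i) <-> exists r, chi i r = q].

Lemma splitting_isomorphic (R : comPzRingType) k
    (chi : 'I_k -> {rmorphism R -> rat}) (m : k.-tuple nat) :
  splits_as chi m -> ring_isomorphic R (Zinv_prod m).
Proof.
move=> [inj [e eE] img].
have chi_in i r : chi i r \in Zinv_pred (tnth m i) by apply/img; exists r.
pose f r : Zinv_prod m := [ffun i => MkZinv (chi_in i r)].
have fE r i : val (f r i) = chi i r by rewrite ffunE.
have fP (x y : Zinv_prod m) : (forall i, val (x i) = val (y i)) -> x = y.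
  by move=> xy; apply/ffunP => i; apply/val_inj/xy.
have f_add : zmod_morphism f.
  by move=> x y; apply: fP => i; rewrite fE rmorphB !ffunE.
have f_mul : monoid_morphism f.
  by split=> [|x y]; apply: fP => i; rewrite fE ?rmorph1 ?rmorphM !ffunE.
have f_inj : injective f.
  move=> x y xy; apply/eqP; rewrite -subr_eq0; apply/eqP/inj => i.
  by rewrite rmorphB /= -!fE xy subrr.
have f_surj y : exists x, f x = y.
  have lift_y i : exists r, chi i r = val (y i) by apply/img/valP.
  (* Preimages of the components are glued by the idempotents. *)
  exists (\sum_i sval (cid (lift_y i)) * e i); apply: fP => i.
  rewrite fE rmorph_sum (bigD1 i) //= rmorphM eE eqxx mulr1 big1 ?addr0.
    by case: cid.
  by move=> j ne_ji; rewrite rmorphM eE eq_sym (negPf ne_ji) mulr0.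
exists (HB.pack_for {rmorphism R -> Zinv_prod m} f
  (GRing.isZmodMorphism.Build _ _ _ f_add) (GRing.isMonoidMorphism.Build _ _ _ f_mul)).
exists (fun y => sval (cid (f_surj y))) => [x|y]; last by case: cid.
by apply: f_inj; case: cid.
Qed.

Lemma isomorphic_splitting (R : comPzRingType) k (m : k.-tuple nat) :
  ring_isomorphic R (Zinv_prod m) ->
  exists chi : 'I_k -> {rmorphism R -> rat}, splits_as chi m.
Proof.
move=> [f [g fK gK]].
have chi_add i : zmod_morphism (fun r => val (f r i)).
  by move=> x y; rewrite rmorphB !ffunE.
have chi_mul i : monoid_morphism (fun r => val (f r i)).
  by split=> [|x y]; rewrite ?rmorph1 ?rmorphM !ffunE.
pose chi i : {rmorphism R -> rat} := HB.pack (fun r => val (f r i))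
  (GRing.isZmodMorphism.Build _ _ _ (chi_add i))
  (GRing.isMonoidMorphism.Build _ _ _ (chi_mul i)).
have chiE i r : chi i r = val (f r i) by [].
exists chi; split.
- move=> r r0; apply: (can_inj fK); rewrite rmorph0.
  by apply/ffunP => i; apply: val_inj; rewrite -chiE r0 ffunE.
- pose u j : Zinv_prod m := [ffun i => (i == j)%:R].
  exists (fun j => g (u j)) => i j; rewrite chiE gK ffunE.
  by rewrite rmorph_nat.
- move=> i q; split=> [qm|[r <-]]; last exact: valP.
  (* Components whose ring does not contain [q] default to [0]; only the component [i] is read. *)
  pose u : Zinv_prod m := [ffun j => insubd (0 : Zinv (tnth m j)) q].
  by exists (g u); rewrite chiE gK ffunE val_insubd qm.
Qed.

(** The [e i] sum to [1], so [psi (e i) != 0] for some [i]. On [e i], every [r] acts as the rational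
    number [chi i r], whence [psi r = chi i r]. *)
Lemma splitting_character (R : comPzRingType) k
    (chi : 'I_k -> {rmorphism R -> rat}) m (psi : {rmorphism R -> rat}) :
  splits_as chi m -> exists i, psi =1 chi i.
Proof.
move=> [inj [e eE] _].
have sum_e : \sum_i e i = 1.
  apply/eqP; rewrite -subr_eq0; apply/eqP/inj => i.
  rewrite rmorphB rmorph1 rmorph_sum (bigD1 i) //= eE eqxx big1 ?addr0 ?subrr //.
  by move=> j ne_ji; rewrite eE eq_sym (negPf ne_ji).
have [i psi_i] : exists i, psi (e i) != 0.
  apply: contrapT => no; have /eqP := rmorph1 psi; apply/negP.
  rewrite -sum_e rmorph_sum big1 ?(eq_sym 0) ?oner_eq0 // => i _.
  by apply/eqP/negPn/negP => ne; apply: no; exists i.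
exists i => r; apply: (mulIf (_ : (denq (chi i r))%:~R != 0)).
  by rewrite intr_eq0.
have re : r * (denq (chi i r))%:~R * e i = (numq (chi i r))%:~R * e i.
  apply/eqP; rewrite -subr_eq0; apply/eqP/inj => j.
  rewrite rmorphB !rmorphM !rmorph_int eE /=; case: eqVneq => [->|_].
    by rewrite numqE subrr.
  by rewrite !mulr0 subrr.
rewrite -numqE; apply: (mulIf psi_i).
by have := congr1 psi re; rewrite !rmorphM !rmorph_int.
Qed.

(** Each character of one splitting occurs in the other, injectively both ways, and matched
    characters have the same image [Z[1/m]], which determines the squarefree [m]. *)
Lemma splitting_unique (R : comPzRingType) k k'
    (chi : 'I_k -> {rmorphism R -> rat}) (chi' : 'I_k' -> {rmorphism R -> rat})
    (m : k.-tuple nat) (m' : k'.-tuple nat) :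
    (forall i, positive_squarefree (tnth m i)) ->
    (forall i, positive_squarefree (tnth m' i)) ->
    splits_as chi m -> splits_as chi' m' ->
  perm_eq m' m.
Proof.
move=> sqf sqf' spl spl'.
have match_inj p q (phi : 'I_p -> {rmorphism R -> rat}) n
    (phi' : 'I_q -> {rmorphism R -> rat}) (s : 'I_p -> 'I_q) :
    splits_as phi n -> (forall i, phi i =1 phi' (s i)) -> injective s.
  move=> [_ [e eE] _] sE i j sij; apply/eqP; have := eE i j.
  by rewrite sE sij -sE eE eqxx; case: eqP.
have sP j : exists i, chi' j =1 chi i := splitting_character (chi' j) spl.
have tP j : exists i, chi j =1 chi' i := splitting_character (chi j) spl'.
pose s j := sval (cid (sP j)); pose t j := sval (cid (tP j)).
have sE j : chi' j =1 chi (s j) by rewrite /s; case: cid.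
have tE j : chi j =1 chi' (t j) by rewrite /t; case: cid.
have s_inj : injective s := match_inj _ _ _ _ _ _ spl' sE.
have t_inj : injective t := match_inj _ _ _ _ _ _ spl tE.
have kk' : k' = k.
  apply/eqP; rewrite eqn_leq.
  by have := leq_card _ s_inj; have := leq_card _ t_inj; rewrite !card_ord => -> ->.
subst k'; apply/tuple_permP; exists (perm s_inj).
congr val; apply: eq_from_tnth => j; rewrite tnth_mktuple permE.
apply: Zinv_eq => // q.
have [_ _ img] := spl; have [_ _ img'] := spl'.
apply/idP/idP => [/img'[r <-]|/img[r <-]].
  by rewrite sE; apply/img; exists r.
by rewrite -sE; apply/img'; exists r.
Qed.

Theorem theorem9 (R : comPzRingType) :
  binomial_ring R -> finitely_generated_ring R ->
  exists (k : nat) (m : k.-tuple nat),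
    (forall i : 'I_k, positive_squarefree (tnth m i))
    /\ ring_isomorphic R (Zinv_prod m)
    /\ forall (k' : nat) (m' : k'.-tuple nat),
         (forall i : 'I_k', positive_squarefree (tnth m' i)) ->
         ring_isomorphic R (Zinv_prod m') ->
         perm_eq m' m.
Proof.
move=> [tf bin0] fg.
have bin : has_binomials R.
  by move=> r n; have [s /(qbinom_mem _ _ _ tf) e] := bin0 r n; exists s.
have [d [chi0 inj0]] := joint_characters tf bin fg.
have [k [chi [inj sep]]] := distinct_joint_characters inj0.
pose m i := s2val (cid2 (character_image (chi i) fg)).
have sqf i : positive_squarefree (tnth (mktuple m) i).
  by rewrite tnth_mktuple /m; case: cid2.
have spl : splits_as chi (mktuple m).
  split=> //; first exact: indicator_of_separation bin sep.
  by move=> i q; rewrite tnth_mktuple /m; case: cid2.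
exists k, (mktuple m); split=> //; split; first exact: splitting_isomorphic spl.
move=> k' m' sqf' /isomorphic_splitting[chi' spl'].
exact: splitting_unique spl spl'.
Qed.
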